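(* Let $U \in \mathrm{SpSt}(2n,2k)$ and $M \in \pi^{-1}(U) \subset \mathrm{Sp}(2n,\mathbb{R})$. Let $\Delta = M\Omega E \in T_U\mathrm{SpSt}(2n,2k)$ with $\Omega \in \mathrm{Hor}^{\pi,h}\mathfrak{sp}(2n,\mathbb{R})$. Then the geodesic $\gamma$ of $\mathrm{SpSt}(2n,2k)$ with respect to the pseudo-Riemannian metric $h^{\mathrm{SpSt}}$ that starts from $\gamma(0)=U$ in direction $\dot\gamma(0)=\Delta$ is $$\gamma(t) = \mathrm{Exp}^{\mathrm{SpSt},h}_U(t\Delta) := \pi\big(\mathrm{Exp}^{\mathrm{Sp},h}_M(t\Delta^{\mathrm{hor}}_M)\big) = M\exp(t\Omega)E = \exp\big(t\tilde\Omega(U,\Delta)\big)U,$$ where $\tilde\Omega(U,\Delta)=M\Omega M^+ = \left(I_{2n}-\frac12UU^+\right)\Delta U^+ - U\Delta^+\left(I_{2n}-\frac12UU^+\right)$.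
   Context: Let $k\le n$ be positive integers, $J_{2m}=\begin{bmatrix}0&I_m\\-I_m&0\end{bmatrix}$, and for a real $2a\times 2b$ matrix $A$ put $A^+:=J_{2b}^TA^TJ_{2a}$ (symplectic inverse). $\mathrm{Sp}(2n,\mathbb{R})=\{M\in\mathbb{R}^{2n\times 2n}: M^+M=I_{2n}\}$, with Lie algebra $\mathfrak{sp}(2n,\mathbb{R})=\{\Omega\in\mathbb{R}^{2n\times2n}:\Omega^+=-\Omega\}$. $\mathrm{SpSt}(2n,2k)=\{U\in\mathbb{R}^{2n\times2k}:U^+U=I_{2k}\}$ is the real symplectic Stiefel manifold, with tangent spaces $T_U\mathrm{SpSt}(2n,2k)=\{\Delta\in\mathbb{R}^{2n\times2k}: U^+\Delta\in\mathfrak{sp}(2k,\mathbb{R})\}$. Let $I_{n,k}=\begin{bmatrix}I_k\\0\end{bmatrix}\in\mathbb{R}^{n\times k}$, $E=\begin{bmatrix}I_{n,k}&0\\0&I_{n,k}\end{bmatrix}\in\mathbb{R}^{2n\times2k}$, and $\pi:\mathrm{Sp}(2n,\mathbb{R})\to\mathrm{SpSt}(2n,2k)$, $\pi(M)=ME$. $\mathrm{Sp}(2n,\mathbb{R})$ carries the bi-invariant pseudo-Riemannian metric $h_M(X_1,X_2)=\frac12\mathrm{tr}(X_1^+X_2)$, whose geodesics are $\mathrm{Exp}^{\mathrm{Sp},h}_M(tX)=M\exp(tM^+X)$ ($\exp$ is the matrix exponential). $\mathrm{Hor}^{\pi,h}\mathfrak{sp}(2n,\mathbb{R})$ is the orthogonal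 complement in $\mathfrak{sp}(2n,\mathbb{R})$, with respect to $h$ at the identity, of the kernel of the differential of $\pi$ at the identity, i.e. of $\{\Omega\in\mathfrak{sp}(2n,\mathbb{R}):\Omega E=0\}$. The horizontal lift of $\Delta\in T_U\mathrm{SpSt}(2n,2k)$ to $M\in\pi^{-1}(U)$ is $\Delta^{\mathrm{hor}}_M=\tilde\Omega(U,\Delta)M = M\Omega$. The pseudo-Riemannian metric on $\mathrm{SpSt}(2n,2k)$ is $h^{\mathrm{SpSt}}_U(\Delta_1,\Delta_2)=\mathrm{tr}\left(\Delta_1^+\left(I_{2n}-\frac12UU^+\right)\Delta_2\right)$, and geodesics are those of its Levi-Civita connection. *)

(* Defs.v *)
From HB Require Import structures.
From mathcomp Require Import all_boot all_order all_algebra.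
From mathcomp Require Import all_classical all_reals all_analysis.

Set Implicit Arguments.
Unset Strict Implicit.
Unset Printing Implicit Defensive.

Import Order.TTheory GRing.Theory Num.Theory.
Import numFieldNormedType.Exports.

Local Open Scope ring_scope.
Local Open Scope classical_set_scope.

Section Smooth.
Context {R : realType} {V W : normedModType R}.

(* For A open and V finite dimensional this is the usual class C^r on A: all
   directional derivatives of order at most r exist and are continuous. *)
Fixpoint Cr (r : nat) (A : set V) (f : V -> W) : Prop :=
  if r is r'.+1 then
    (forall x, A x -> differentiable f x) /\
    (forall v : V, Cr r' A (fun x => 'D_v f x))
  else forall x, A x -> {for x, continuous f}.

Definition smooth_on (A : set V) (f : V -> W) : Prop := forall r, Cr r A f.

End Smooth.

(* Pseudo-Riemannian geometry of a closed embedded submanifold S of a finite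
   dimensional space V; T p is the tangent space of S at p and h p the metric
   on T p.  Every smooth map on such an S is the restriction of a smooth map on
   V, so functions, vector fields and the metric are handled through ambient
   representatives, and only their values on S matter. *)
Section LeviCivita.
Context {R : realType} {V : normedModType R}.
Variables (S : set V) (T : V -> set V) (h : V -> V -> V -> R).

Definition vector_field (X : V -> V) : Prop :=
  smooth_on setT X /\ (forall p, S p -> T p (X p)).

(* nabla p v Y stands for (nabla_v Y)(p), with v in T p. *)
Record affine_connection (nabla : V -> V -> (V -> V) -> V) : Prop := {
  conn_ext : forall p v Y Y', S p -> T p v ->
    vector_field Y -> vector_field Y' -> (forall q, S q -> Y q = Y' q) ->
    nabla p v Y = nabla p v Y';
  conn_field : forall X Y, vector_field X -> vector_field Y ->
    exists2 Z, vector_field Z & forall p, S p -> Z p = nabla p (X p) Y;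
  conn_linear : forall p (a : R) v w Y, S p -> T p v -> T p w ->
    vector_field Y ->
    nabla p (a *: v + w) Y = a *: nabla p v Y + nabla p w Y;
  conn_add : forall p v Y Z, S p -> T p v ->
    vector_field Y -> vector_field Z ->
    nabla p v (fun q => Y q + Z q) = nabla p v Y + nabla p v Z;
  conn_leibniz : forall p v (f : V -> R) Y, S p -> T p v ->
    smooth_on setT f -> vector_field Y ->
    nabla p v (fun q => f q *: Y q) = 'D_v f p *: Y p + f p *: nabla p v Y }.

Definition torsion_free (nabla : V -> V -> (V -> V) -> V) : Prop :=
  forall p X Y, S p -> vector_field X -> vector_field Y ->
  nabla p (X p) Y - nabla p (Y p) X = 'D_(X p) Y p - 'D_(Y p) X p.

Definition metric_compatible (nabla : V -> V -> (V -> V) -> V) : Prop :=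
  forall p v Y Z, S p -> T p v -> vector_field Y -> vector_field Z ->
  'D_v (fun q => h q (Y q) (Z q)) p =
  h p (nabla p v Y) (Z p) + h p (Y p) (nabla p v Z).

Definition levi_civita (nabla : V -> V -> (V -> V) -> V) : Prop :=
  [/\ affine_connection nabla, torsion_free nabla & metric_compatible nabla].

Definition field_along (I : set R) (gamma : R -> V) (X : R -> V) : Prop :=
  smooth_on I X /\ (forall t, I t -> T (gamma t) (X t)).

Record covariant_derivative_along (nabla : V -> V -> (V -> V) -> V)
    (I : set R) (gamma : R -> V) (D : (R -> V) -> (R -> V)) : Prop := {
  cov_ext : forall X Y, field_along I gamma X -> field_along I gamma Y ->
    (forall t, I t -> X t = Y t) -> (forall t, I t -> D X t = D Y t);
  cov_field : forall X, field_along I gamma X -> field_along I gamma (D X);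
  cov_add : forall X Y, field_along I gamma X -> field_along I gamma Y ->
    forall t, I t -> D (fun s => X s + Y s) t = D X t + D Y t;
  cov_leibniz : forall (f : R -> R) X, smooth_on I f ->
    field_along I gamma X ->
    forall t, I t -> D (fun s => f s *: X s) t = derive1 f t *: X t + f t *: D X t;
  cov_restr : forall Y, vector_field Y ->
    forall t, I t -> D (fun s => Y (gamma s)) t = nabla (gamma t) (derive1 gamma t) Y }.

(* On S, the Levi-Civita connection is unique, and so is D on I, so that the
   existential quantifiers below only give them a name. *)
Definition is_geodesic (I : set R) (gamma : R -> V) : Prop :=
  [/\ smooth_on I gamma, forall t, I t -> S (gamma t) &
    exists2 nabla, levi_civita nabla &
    exists2 D, covariant_derivative_along nabla I gamma D &
      forall t, I t -> D (derive1 gamma) t = 0].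

End LeviCivita.

Definition expm {R : realType} {m : nat} (A : 'M[R]_m) : 'M[R]_m :=
  limn (series (fun i : nat => (i`!%:R)^-1 *: A ^+ i)).

Section Symplectic.
Context {R : realType}.

Definition J (m : nat) : 'M[R]_(m + m) := block_mx 0 1%:M (- 1%:M) 0.

Definition sinv {a b : nat} (A : 'M[R]_(a + a, b + b)) : 'M[R]_(b + b, a + a) :=
  (J b)^T *m A^T *m J a.

Definition Sp (n : nat) : set 'M[R]_(n + n) := [set M | sinv M *m M = 1%:M].

Definition sp (n : nat) : set 'M[R]_(n + n) := [set Om | sinv Om = - Om].

Definition tangent_Sp (n : nat) (M : 'M[R]_(n + n)) : set 'M[R]_(n + n) :=
  [set X | sp (sinv M *m X)].

(* As h_M does not involve M, the base point is not an argument. *)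
Definition h_Sp (n : nat) (X1 X2 : 'M[R]_(n + n)) : R :=
  2^-1 * \tr (sinv X1 *m X2).

Definition Exp_Sp (n : nat) (M X : 'M[R]_(n + n)) : 'M[R]_(n + n) :=
  M *m expm (sinv M *m X).

Definition SpSt (n k : nat) : set 'M[R]_(n + n, k + k) :=
  [set U | sinv U *m U = 1%:M].

Definition tangent_SpSt (n k : nat) (U : 'M[R]_(n + n, k + k)) :
    set 'M[R]_(n + n, k + k) :=
  [set Delta | sp (sinv U *m Delta)].

Definition h_SpSt (n k : nat) (U D1 D2 : 'M[R]_(n + n, k + k)) : R :=
  \tr (sinv D1 *m (1%:M - 2^-1 *: (U *m sinv U)) *m D2).

(* For k <= n, pid_mx k : 'M_(n, k) is I_{n,k}. *)
Definition E (n k : nat) : 'M[R]_(n + n, k + k) :=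
  block_mx (pid_mx k) 0 0 (pid_mx k).

Definition pi_SpSt (n k : nat) (M : 'M[R]_(n + n)) : 'M[R]_(n + n, k + k) :=
  M *m E n k.

(* pi_SpSt is linear, so its differential at any point is X |-> X *m E n k. *)
Definition hor_sp (n k : nat) : set 'M[R]_(n + n) :=
  [set Om | sp Om /\
    forall Om', sp Om' -> Om' *m E n k = 0 -> h_Sp Om Om' = 0].

Definition horizontal_lift (n k : nat) (M : 'M[R]_(n + n))
    (Delta : 'M[R]_(n + n, k + k)) (X : 'M[R]_(n + n)) : Prop :=
  [/\ tangent_Sp M X,
      forall Y, tangent_Sp M Y -> Y *m E n k = 0 -> h_Sp X Y = 0 &
      X *m E n k = Delta].

Definition Omega_tilde (n k : nat) (U Delta : 'M[R]_(n + n, k + k)) :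
    'M[R]_(n + n) :=
  (1%:M - 2^-1 *: (U *m sinv U)) *m Delta *m sinv U
  - U *m sinv Delta *m (1%:M - 2^-1 *: (U *m sinv U)).

End Symplectic.

Arguments J {R} m.
Arguments E {R} n k.
Arguments pi_SpSt {R n} k M.
Arguments hor_sp {R} n k.
Arguments SpSt {R} n k.
Arguments Sp {R} n.

(* Main.v *)
Require Import Defs.
From HB Require Import structures.
From mathcomp Require Import all_boot all_order all_algebra.
From mathcomp Require Import all_classical all_reals all_analysis.
Import Order.TTheory GRing.Theory Num.Theory.
Import numFieldNormedType.Exports.
Local Open Scope ring_scope.
Local Open Scope classical_set_scope.
From mathcomp Require Import ring.

Set Implicit Arguments.
Unset Strict Implicit.
Unset Printing Implicit Defensive.

(** Write A^+ for the symplectic adjoint and S for SpSt(2n,2k).  The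
    group Sp(2n) acts on S by left multiplication and isometrically, so for every
    A in sp(2n) the linear map q |-> A q restricts to a Killing field of S.  The
    matrix Omega_tilde(U,D) is the distinguished element of sp(2n) whose Killing
    field takes the value D at U: it is skew by its very shape, it satisfies
    Omega_tilde(U,D) U = D for tangent D ([Omega_tilde_id]), and the metric is
    the trace form in disguise,
<<
      h_U(D, A U) = - 1/2 tr (Omega_tilde(U,D) A)    for A in sp(2n)
>>
    ([h_SpSt_sp]).  Since the trace form is nondegenerate on sp(2n), this pins
    Omega_tilde(U,D) down as the only Z in sp(2n) with Z U = D that is orthogonal
    to the stabiliser of U ([Omega_tilde_unique]).  Translated from the
    identity to M, this says that M Om and Omega_tilde(U,D) M are both the
    horizontal lift of D, which gives the formula for M Om M^+; the equality of
    the two expressions for the curve is then the fact that exp intertwines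
    conjugate matrices.

    The curve is a geodesic.  Along a curve c in S a tangent field X is B c with
    B = Omega_tilde(c,X), and c' = A c with A = Omega_tilde(c,c').  The bi-invariant
    metric of the group suggests the covariant derivative (B' + [B,A]/2) c, which
    in ambient terms is X' - (A B + B A) c / 2: flat differentiation corrected
    by a symmetric Christoffel term.  It is visibly tangent, the symmetry makes
    it torsion-free, and the invariance of the trace form makes it metric
    ([curve_covariant], [curve_metric], [SpSt_levi_civita]).  Every quantity
    is tested on curves inside S, which is why the values on S alone matter.  For
    c(t) = exp(tZ) U with Z = Omega_tilde(U,D), equivariance of Omega_tilde keeps
    Omega_tilde(c,c') equal to Z, so the covariant acceleration is
    Z Z c - (Z Z + Z Z) c / 2 = 0.

    It is the only one.  Let c be a geodesic for an arbitrary Levi-Civita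
    connection and an arbitrary covariant derivative along c.  Noether's theorem
    applies: the invariance of h gives the Killing equation h(v, nabla_v (A q)) = 0
    ([killing_equation]), hence each momentum h(c', A c) is constant along c
    ([derive_killing_momentum]).  By the displayed formula and nondegeneracy all
    these momenta together say that Omega_tilde(c,c') is a constant matrix Z, so
    that c' = Z c is a linear equation with constant coefficients, and
    c(t) = exp(tZ) c(0) ([geodesic_expm]). *)

(** * The symplectic adjoint *)

(** The symplectic inverse is itself a product of matrices; locking it keeps
    rewriting with associativity and distributivity from looking inside. *)
HB.lock Definition sadj {R : realType} {a b : nat}
  (A : 'M[R]_(a + a, b + b)) : 'M[R]_(b + b, a + a) := sinv A.

Section SymplecticAdjoint.
Context {R : realType}.

Lemma sinv_sadj a b (A : 'M[R]_(a + a, b + b)) : sinv A = sadj A.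
Proof. by rewrite unlock. Qed.

Lemma trmx_J m : (J m)^T = - J m :> 'M[R]_(m + m).
Proof.
by rewrite /J tr_block_mx !trmx0 trmx1 linearN /= trmx1 opp_block_mx oppr0 opprK.
Qed.

Lemma mulJJ m : J m *m J m = - 1%:M :> 'M[R]_(m + m).
Proof.
rewrite /J mulmx_block !mul0mx !mulmx0 !addr0 ?add0r mul1mx mulmx1.
by rewrite (scalar_mx_block m m 1) opp_block_mx oppr0.
Qed.

Lemma sadjE a b (A : 'M[R]_(a + a, b + b)) : sadj A = - (J b *m A^T *m J a).
Proof. by rewrite unlock /sinv trmx_J !mulNmx. Qed.

Lemma sadjM a b c (A : 'M[R]_(a + a, b + b)) (B : 'M[R]_(b + b, c + c)) :
  sadj (A *m B) = sadj B *m sadj A.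
Proof.
rewrite !sadjE mulNmx mulmxN opprK trmx_mul !mulmxA.
by rewrite -(mulmxA _ (J b) (J b)) mulJJ mulmxN mulmx1 !mulNmx.
Qed.

Lemma sadjK a b (A : 'M[R]_(a + a, b + b)) : sadj (sadj A) = A.
Proof.
rewrite !sadjE linearN /= !trmx_mul trmxK !trmx_J mulmxN !mulNmx !mulmxN.
rewrite !opprK !mulmxA mulJJ mulNmx mul1mx -mulmxA mulJJ.
by rewrite mulNmx mulmxN mulmx1 !opprK.
Qed.

Lemma sadj_is_linear a b : linear (@sadj R a b).
Proof.
move=> c A B; rewrite unlock /sinv linearP mulmxDr mulmxDl.
by rewrite -scalemxAr -scalemxAl.
Qed.

HB.instance Definition _ a b := GRing.isLinear.Build R _ _ _ (@sadj R a b)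
  (@sadj_is_linear a b).

Lemma sadjD a b (A B : 'M[R]_(a + a, b + b)) : sadj (A + B) = sadj A + sadj B.
Proof. exact: linearD. Qed.

Lemma sadjB a b (A B : 'M[R]_(a + a, b + b)) : sadj (A - B) = sadj A - sadj B.
Proof. exact: linearB. Qed.

Lemma sadjN a b (A : 'M[R]_(a + a, b + b)) : sadj (- A) = - sadj A.
Proof. exact: linearN. Qed.

Lemma sadjZ a b c (A : 'M[R]_(a + a, b + b)) : sadj (c *: A) = c *: sadj A.
Proof. exact: linearZ. Qed.

Lemma sadj1 m : sadj (1%:M : 'M[R]_(m + m)) = 1%:M.
Proof. by rewrite sadjE trmx1 mulmx1 mulJJ opprK. Qed.

Lemma mxtrace_sadj m (A : 'M[R]_(m + m)) : \tr (sadj A) = \tr A.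
Proof.
rewrite sadjE linearN /= -mulmxA mxtrace_mulC -mulmxA mulJJ.
by rewrite mulmxN mulmx1 linearN /= opprK mxtrace_tr.
Qed.

Lemma SpE n (g : 'M[R]_(n + n)) : Sp n g = (sadj g *m g = 1%:M).
Proof. by rewrite /Sp /= sinv_sadj. Qed.

Lemma spE n (A : 'M[R]_(n + n)) : sp A = (sadj A = - A).
Proof. by rewrite /sp /= sinv_sadj. Qed.

Lemma SpStE n k (U : 'M[R]_(n + n, k + k)) :
  SpSt n k U = (sadj U *m U = 1%:M).
Proof. by rewrite /SpSt /= sinv_sadj. Qed.

Lemma tangent_SpStE n k (U D : 'M[R]_(n + n, k + k)) :
  tangent_SpSt U D = (sadj D *m U = - (sadj U *m D)).
Proof. by rewrite /tangent_SpSt /= spE !sinv_sadj sadjM sadjK. Qed.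

Lemma Sp_mulmxV n (g : 'M[R]_(n + n)) : Sp n g -> g *m sadj g = 1%:M.
Proof. by rewrite SpE => /mulmx1C. Qed.

Lemma SpK n m (g : 'M[R]_(n + n)) (A : 'M[R]_(n + n, m)) :
  Sp n g -> sadj g *m (g *m A) = A.
Proof. by rewrite SpE mulmxA => ->; rewrite mul1mx. Qed.

Lemma sp_skew n (A : 'M[R]_(n + n)) : sp (A - sadj A).
Proof. by rewrite spE sadjB sadjK opprB. Qed.

Lemma spD n (A B : 'M[R]_(n + n)) : sp A -> sp B -> sp (A + B).
Proof. by rewrite !spE sadjD opprD => -> ->. Qed.

Lemma spN n (A : 'M[R]_(n + n)) : sp A -> sp (- A).
Proof. by rewrite !spE sadjN => ->. Qed.

Lemma spZ n c (A : 'M[R]_(n + n)) : sp A -> sp (c *: A).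
Proof. by rewrite !spE sadjZ => ->; rewrite scalerN. Qed.

Lemma sp_bracket n (A B : 'M[R]_(n + n)) : sp A -> sp B -> sp (A *m B - B *m A).
Proof.
by rewrite !spE sadjB !sadjM => -> ->; rewrite !mulmxN !mulNmx !opprK opprB.
Qed.

Lemma sp_conj n (g A : 'M[R]_(n + n)) : sp A -> sp (g *m A *m sadj g).
Proof.
by rewrite !spE !sadjM sadjK => ->; rewrite mulmxA mulmxN mulNmx.
Qed.

Lemma scale_half2 (V : lmodType R) (x : V) : 2^-1 *: x + 2^-1 *: x = x.
Proof.
by rewrite -scalerDl [X in X *: _](_ : _ = 1) ?scale1r // [RHS](splitr 1) div1r.
Qed.

Lemma sp_half n (A : 'M[R]_(n + n)) : sp A -> A = 2^-1 *: (A - sadj A).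
Proof. by rewrite spE => ->; rewrite opprK scalerDr scale_half2. Qed.

Lemma mxtrace_nondeg m (A : 'M[R]_m) : (forall B, \tr (A *m B) = 0) -> A = 0.
Proof.
move=> A0; apply/matrixP => i j; rewrite mxE.
rewrite -(A0 (delta_mx j i)) mxtrace_mulC /mxtrace (bigD1 j) //= big1 => [|l lj].
  rewrite addr0 mxE (bigD1 i) //= big1 => [|l li].
    by rewrite addr0 mxE !eqxx mul1r.
  by rewrite mxE eqxx (negbTE li) mul0r.
by rewrite mxE big1 // => p _; rewrite mxE (negbTE lj) mul0r.
Qed.

(** Pairing W with the two parts B - B^+ and B + B^+ of an arbitrary B: the second
    pairing vanishes because W is skew, so the first carries the whole trace
    form, which is nondegenerate. *)
Lemma sp_nondeg n (W : 'M[R]_(n + n)) : sp W ->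
  (forall A, sp A -> \tr (W *m A) = 0) -> W = 0.
Proof.
rewrite spE => spW W0; apply: mxtrace_nondeg => B.
have := W0 _ (sp_skew B); rewrite mulmxBr linearB /=.
rewrite -[\tr (W *m sadj B)]mxtrace_sadj sadjM sadjK spW mulmxN.
rewrite linearN /= opprK mxtrace_mulC -mulr2n => /eqP.
by rewrite mulrn_eq0 /= => /eqP; rewrite mxtrace_mulC.
Qed.

Section OmegaTilde.
Context {n k : nat}.
Implicit Types (U D v w : 'M[R]_(n + n, k + k)) (A B g : 'M[R]_(n + n)).

(** For U on the manifold, U U^+ is the projection onto the column space of U along
    its symplectic complement; halving it gives the self-adjoint factor common to
    the metric and to Omega_tilde. *)
Definition halfproj U := 1%:M - 2^-1 *: (U *m sadj U).

Lemma sadj_halfproj U : sadj (halfproj U) = halfproj U.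
Proof. by rewrite /halfproj sadjB sadjZ sadjM sadjK sadj1. Qed.

Lemma Omega_tildeE U D : Omega_tilde U D =
  halfproj U *m D *m sadj U - U *m sadj D *m halfproj U.
Proof. by rewrite /Omega_tilde !sinv_sadj. Qed.

(** The shape S - S^+ puts Omega_tilde(U,D) in sp(2n) for all U and D, even off
    the manifold, which lets it be differentiated along curves within sp(2n). *)
Lemma Omega_tilde_skew U D :
  Omega_tilde U D = halfproj U *m D *m sadj U - sadj (halfproj U *m D *m sadj U).
Proof. by rewrite Omega_tildeE !sadjM sadjK sadj_halfproj mulmxA. Qed.

Lemma h_SpStE U D D' : h_SpSt U D D' = \tr (sadj D *m halfproj U *m D').
Proof. by rewrite /h_SpSt !sinv_sadj. Qed.

Lemma sp_Omega_tilde U D : sp (Omega_tilde U D).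
Proof. rewrite Omega_tilde_skew; exact: sp_skew. Qed.

Lemma Omega_tilde_is_linear U : linear (Omega_tilde U).
Proof.
move=> c D D'; rewrite !Omega_tildeE; move: (halfproj U) => Q.
rewrite sadjD sadjZ !mulmxDr !mulmxDl.
by rewrite -!(scalemxAr, scalemxAl) scalerBr opprD addrACA.
Qed.

HB.instance Definition _ U := GRing.isLinear.Build R _ _ _ (@Omega_tilde R n k U)
  (Omega_tilde_is_linear U).

Lemma halfproj_id U : SpSt n k U -> halfproj U *m U = 2^-1 *: U.
Proof.
rewrite SpStE /halfproj mulmxBl mul1mx -scalemxAl -mulmxA => ->; rewrite mulmx1.
by rewrite -[X in X - _](scale_half2 U) addrK.
Qed.

(** Tangency of D turns the second term into U U^+ D / 2, exactly what the first
    one lacks. *)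
Lemma Omega_tilde_id U D : SpSt n k U -> tangent_SpSt U D ->
  Omega_tilde U D *m U = D.
Proof.
rewrite SpStE tangent_SpStE => US UD.
rewrite Omega_tildeE mulmxBl -!mulmxA US mulmx1 halfproj_id ?SpStE //.
rewrite -!scalemxAr UD mulmxN scalerN opprK /halfproj mulmxBl mul1mx -scalemxAl.
by rewrite mulmxA subrK.
Qed.

Lemma tangent_SpSt_sp U A : sp A -> tangent_SpSt U (A *m U).
Proof. by rewrite spE tangent_SpStE sadjM => ->; rewrite mulmxN mulNmx mulmxA. Qed.

(** The metric as a trace form: writing Omega_tilde(U,D) = S - S^+ as in
    [Omega_tilde_skew], h_U(D, A U) = tr (S^+ A) by cyclicity, and
    tr (S A) = - tr (S^+ A) because A is skew.  Both the metric compatibility and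
    the conservation of momentum are read off from this. *)
Lemma h_SpSt_sp U D A : sp A ->
  h_SpSt U D (A *m U) = - 2^-1 * \tr (Omega_tilde U D *m A).
Proof.
rewrite spE => spA; rewrite Omega_tilde_skew mulmxBl linearB /=.
set S := halfproj U *m D *m sadj U.
have -> : \tr (S *m A) = - \tr (sadj S *m A).
  by rewrite -mxtrace_sadj sadjM spA mulNmx linearN /= mxtrace_mulC.
have -> : h_SpSt U D (A *m U) = \tr (sadj S *m A).
  by rewrite /S !sadjM sadjK sadj_halfproj h_SpStE mulmxA mxtrace_mulC !mulmxA.
rewrite -opprD mulrNN mulrDr -mulrDl [X in X * _](_ : _ = 1) ?mul1r //.
by rewrite [RHS](splitr 1) div1r.
Qed.

Lemma h_SpSt_sym U D D' : h_SpSt U D D' = h_SpSt U D' D.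
Proof. by rewrite !h_SpStE -mxtrace_sadj !sadjM sadjK sadj_halfproj mulmxA. Qed.

Lemma Omega_tilde_conj g U D : Sp n g ->
  Omega_tilde (g *m U) (g *m D) = g *m Omega_tilde U D *m sadj g.
Proof.
move=> gS; rewrite !Omega_tilde_skew.
have -> : halfproj (g *m U) = g *m halfproj U *m sadj g.
  rewrite /halfproj mulmxBr mulmxBl mulmx1 (Sp_mulmxV gS) sadjM.
  by rewrite -scalemxAr -scalemxAl !mulmxA.
have -> : g *m halfproj U *m sadj g *m (g *m D) *m sadj (g *m U) =
    g *m (halfproj U *m D *m sadj U) *m sadj g.
  by rewrite sadjM -!mulmxA SpK.
move: (halfproj U *m D *m sadj U) => S.
by rewrite mulmxBr mulmxBl !sadjM sadjK !mulmxA.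
Qed.

(** Horizontality in right-trivialised form.  Orthogonality of Omega_tilde to the
    stabiliser of U is [h_SpSt_sp] at A U = 0.  For uniqueness, the difference W
    of two solutions kills U and, being skew, has its image in the kernel of U^+;
    hence W = Q W Q for the projection Q = 1 - U U^+.  As Q A Q stabilises U for
    every A in sp(2n), tr (W A) = tr (W (Q A Q)) = 0, and nondegeneracy applies. *)
Lemma Omega_tilde_unique U D Z : SpSt n k U -> tangent_SpSt U D ->
  [/\ sp Z, Z *m U = D &
    forall W, sp W -> W *m U = 0 -> \tr (Z *m W) = 0] <->
  Z = Omega_tilde U D.
Proof.
move=> US UD.
have orth W : sp W -> W *m U = 0 -> \tr (Omega_tilde U D *m W) = 0.
  move=> spW WU; have := h_SpSt_sp U D spW.
  rewrite WU h_SpStE mulmx0 linear0 => /eqP; rewrite eq_sym mulf_eq0.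
  by rewrite oppr_eq0 invr_eq0 pnatr_eq0 /= => /eqP.
split=> [[spZ ZU Zorth]|->]; last first.
  by split; [exact: sp_Omega_tilde|exact: Omega_tilde_id|].
apply/eqP; rewrite -subr_eq0; apply/eqP.
set W := Z - _.
have spW : sp W by apply: spD => //; apply/spN/sp_Omega_tilde.
have WU : W *m U = 0 by rewrite mulmxBl ZU Omega_tilde_id // subrr.
have Worth A : sp A -> A *m U = 0 -> \tr (W *m A) = 0.
  by move=> spA AU; rewrite mulmxBl linearB /= Zorth // orth // subr0.
(* The projection onto the symplectic complement of the columns of U. *)
pose Q := 1%:M - U *m sadj U.
have QU : Q *m U = 0.
  by move: US; rewrite SpStE mulmxBl mul1mx -mulmxA => ->; rewrite mulmx1 subrr.
have sQ : sadj Q = Q by rewrite /Q sadjB sadjM sadjK sadj1.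
have WQ : W *m Q = W by rewrite mulmxBr mulmx1 mulmxA WU mul0mx subr0.
have QW : Q *m W = W.
  have : sadj (W *m Q) = sadj W by rewrite WQ.
  by move: spW; rewrite spE sadjM sQ => ->; rewrite mulmxN => /oppr_inj.
apply: (sp_nondeg spW) => A spA.
have <- : \tr (W *m (Q *m A *m Q)) = \tr (W *m A).
  by rewrite !mulmxA WQ mxtrace_mulC !mulmxA QW.
apply: Worth; last by rewrite -(mulmxA (Q *m A)) QU mulmx0.
by have := sp_conj Q spA; rewrite sQ.
Qed.

End OmegaTilde.
End SymplecticAdjoint.

(** * Derivatives and smoothness of matrix-valued functions *)

Section Calculus.
Context {R : realType}.

Lemma cvg_fin_sum (T : Type) (F : set_system T) {FF : Filter F} (W : normedModType R)
    n (f : 'I_n -> T -> W) (l : 'I_n -> W) :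
  (forall i, f i x @[x --> F] --> l i) ->
  \sum_i f i x @[x --> F] --> \sum_i l i.
Proof.
move=> fl; elim: n => [|n IH] in f l fl *.
  by rewrite big_ord0; under eq_fun do rewrite big_ord0; exact: cvg_cst.
rewrite big_ord_recr; under eq_fun do rewrite big_ord_recr.
by apply: cvgD => //; exact: IH.
Qed.

(** A linear map out of a matrix space is a finite sum of coordinates times fixed
    vectors. *)
Lemma mx_lin_continuous m n (W : normedModType R)
  (L : {linear 'M[R]_(m, n) -> W}) : continuous L.
Proof.
have -> : (L : 'M[R]_(m, n) -> W) =
    fun M => \sum_i \sum_j M i j *: L (delta_mx i j).
  apply/funext => M; rewrite [in LHS](matrix_sum_delta M) linear_sum.
  by apply: eq_bigr => i _; rewrite linear_sum; apply: eq_bigr => j _; rewrite linearZ.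
move=> M; apply: (@cvg_fin_sum _ (nbhs M)) => i; apply: (@cvg_fin_sum _ (nbhs M)) => j.
by apply: cvgZr_tmp; exact: coord_continuous.
Qed.

Lemma is_derive_lin (V W W' : normedModType R) (L : {linear W -> W'})
    (F : V -> W) x v dF : continuous L ->
  is_derive x v F dF -> is_derive x v (fun y => L (F y)) (L dF).
Proof.
move=> Lc [/cvg_ex[l Fl] <-].
have FE : 'D_v F x = l by exact: cvg_lim.
have LF : h^-1 *: (L (F (h *: v + x)) - L (F x)) @[h --> 0^'] --> L l.
  have := cvg_comp _ _ Fl (Lc l).
  apply: cvg_trans; apply: near_eq_cvg; near=> h => /=.
  by rewrite -linearB -linearZ.
rewrite FE; split; first by apply/cvg_ex; exists (L l).
exact: cvg_lim.
Unshelve. all: by end_near. Qed.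

Lemma is_derive_mxlin (V W' : normedModType R) m n (L : {linear 'M[R]_(m, n) -> W'})
    (F : V -> 'M[R]_(m, n)) x v dF : 
  is_derive x v F dF -> is_derive x v (fun y => L (F y)) (L dF).
Proof. by apply: is_derive_lin; exact: mx_lin_continuous. Qed.

Lemma is_derive_mx (V : normedModType R) m n (F : V -> 'M[R]_(m, n)) x v
    (dF : 'M[R]_(m, n)) :
  (forall i j, is_derive x v (fun y => F y i j) (dF i j)) -> is_derive x v F dF.
Proof.
move=> dFij; have FD : derivable F x v by apply/derivable_mxP => i j; case: (dFij i j).
split => //; rewrite derive_mx //; apply/matrixP => i j; rewrite mxE.
by case: (dFij i j).
Qed.

Lemma is_derive_coord (V : normedModType R) m n (F : V -> 'M[R]_(m, n)) x v
    (dF : 'M[R]_(m, n)) i j :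
  is_derive x v F dF -> is_derive x v (fun y => F y i j) (dF i j).
Proof.
move=> [FD <-]; split; first by move/derivable_mxP : FD.
by rewrite derive_mx // mxE.
Qed.

Lemma is_derive_mulmx (V : normedModType R) m n p (F : V -> 'M[R]_(m, n))
    (G : V -> 'M[R]_(n, p)) x v (dF : 'M[R]_(m, n)) (dG : 'M[R]_(n, p)) :
  is_derive x v F dF -> is_derive x v G dG ->
  is_derive x v (fun y => F y *m G y) (dF *m G x + F x *m dG).
Proof.
move=> FD GD; apply: is_derive_mx => i j.
have -> : (fun y => (F y *m G y) i j) = \sum_k ((fun y => F y i k) * (fun y => G y k j)).
  by apply/funext => y; rewrite mxE fct_sumE.
apply: is_derive_eq.
  apply: is_derive_sum => k; apply: is_deriveM; exact: is_derive_coord.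
rewrite !mxE -big_split; apply: eq_bigr => k _ /=.
by rewrite addrC /GRing.scale /= [G x k j * _]mulrC.
Qed.

Lemma is_derive_funext (V W : normedModType R) (F G : V -> W) x v dF : F = G ->
  is_derive x v F dF -> is_derive x v G dF.
Proof. by move=> ->. Qed.

Lemma is_derive_comp (V W : normedModType R) (c : R -> V) (F : V -> W) (t : R) (dc : V) :
  is_derive t 1 c dc -> differentiable F (c t) ->
  is_derive t 1 (fun s => F (c s)) ('D_dc F (c t)).
Proof.
move=> [cD <-] FD; have cd : differentiable c t by apply/derivable1_diffP.
have Fcd : differentiable (F \o c) t by exact: differentiable_comp.
split; first exact/derivable1_diffP.
by rewrite !deriveE // diff_comp.
Qed.

Lemma is_derive_0_cst (I : set R) (F : R -> R) : is_interval I ->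
  (forall t : R, I t -> is_derive t 1 F 0) -> forall s t, I s -> I t -> F s = F t.
Proof.
move=> Ii FD; suff le s t : I s -> I t -> s <= t -> F s = F t.
  by move=> s t Is It; case: (leP s t) => [/le ->//|/ltW /le ->].
move=> Is It st.
have Ix x : s <= x <= t -> I x by move=> ?; exact: (Ii s t).
have [|||c _] := @MVT_segment R F (fun=> 0) s t.
- exact: st.
- by move=> x xst; apply: FD; apply: Ix; rewrite !(itvP xst).
- apply: derivable_within_continuous => x xst.
  by case: (FD x) => //; apply: Ix; rewrite !(itvP xst).
by rewrite mul0r => /eqP; rewrite subr_eq0 => /eqP.
Qed.

(** The mean value theorem, entry by entry; the ordinary differential equations
    below are all solved by exhibiting a quantity with zero derivative. *)
Lemma is_derive_mx_0_cst m n (I : set R) (F : R -> 'M[R]_(m, n)) : is_interval I ->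
  (forall t : R, I t -> is_derive t 1 F 0) -> forall s t, I s -> I t -> F s = F t.
Proof.
move=> Ii FD s t Is It; apply/matrixP => i j.
apply: (@is_derive_0_cst I (fun t => F t i j)) => // r Ir.
by have := is_derive_coord i j (FD r Ir); rewrite mxE.
Qed.

(** Two maps agreeing near x have the same first-order expansion at x, and the
    linear part of such an expansion is unique. *)
Lemma near_eq_differentiable (V W : normedModType R) (f g : V -> W) x :
  (\near x, f x = g x) -> differentiable f x -> differentiable g x.
Proof.
move=> fg fD; have [dc /eqaddoP fo] := (diff_locallyP _ _).1 fD.
have go : g \o shift x = cst (g x) + 'd f x +o_ 0 id.
  apply/eqaddoP => e e0; have := fo e e0.
  have : \forall y \near 0, f (y + x) = g (y + x).
    move: (fg); rewrite (near_shift 0) => fg0; apply: filterS fg0 => y.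
    by rewrite /= subr0.
  move=> fg0; have fgx : f x = g x by exact: (nbhs_singleton fg).
  apply: filterS2 fg0 => y fgy.
  by rewrite !fctE /= -fgy fgx.
have E : 'd g x = 'd f x :> (V -> W) by exact: diff_unique.
by apply/diff_locallyP; rewrite E.
Qed.

Lemma derivative_unique (V W : normedModType R) (F : V -> W) x v d d' :
  is_derive x v F d -> is_derive x v F d' -> d = d'.
Proof. by move=> [_ <-] [_ <-]. Qed.

Lemma is_derive_add (V W : normedModType R) (F G : V -> W) x v dF dG :
  is_derive x v F dF -> is_derive x v G dG ->
  is_derive x v (fun y => F y + G y) (dF + dG).
Proof. exact: is_deriveD. Qed.

Lemma is_derive_sub (V W : normedModType R) (F G : V -> W) x v dF dG :
  is_derive x v F dF -> is_derive x v G dG ->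
  is_derive x v (fun y => F y - G y) (dF - dG).
Proof. exact: is_deriveB. Qed.

Lemma is_derive_fin_sum (U W : normedModType R) (J : finType)
    (f : J -> U -> W) (df : J -> W) x v :
  (forall j, is_derive x v (f j) (df j)) ->
  is_derive x v (fun y => \sum_j f j y) (\sum_j df j).
Proof.
move=> fD; elim: (index_enum J) => [|j r IH].
  rewrite big_nil (_ : (fun y => _) = cst 0); first exact: is_derive_cst.
  by apply/funext => y; rewrite big_nil.
rewrite big_cons (_ : (fun y => _) = fun y => f j y + \sum_(j <- r) f j y).
  exact: is_derive_add.
by apply/funext => y; rewrite big_cons.
Qed.

Lemma is_derive_mxscale (V : normedModType R) m n (f : V -> R)
    (G : V -> 'M[R]_(m, n)) x v (df : R) (dG : 'M[R]_(m, n)) :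
  is_derive x v f df -> is_derive x v G dG ->
  is_derive x v (fun y => f y *: G y) (df *: G x + f x *: dG).
Proof.
move=> fD GD; apply: is_derive_mx => i j; rewrite !mxE.
rewrite (_ : (fun y => _) = (f * (fun y => G y i j))); last first.
  by apply/funext => y; rewrite mxE.
apply: is_derive_eq; first by apply: is_deriveM; exact: is_derive_coord.
by rewrite addrC /GRing.scale /= [G x i j * _]mulrC.
Qed.

Lemma smooth_differentiable (V W : normedModType R) (A : set V) (f : V -> W) x :
  smooth_on A f -> A x -> differentiable f x.
Proof. by move=> /(_ 1) [fD _]; exact: fD. Qed.

Lemma smooth_is_derive (V W : normedModType R) (A : set V) (f : V -> W) x v :
  smooth_on A f -> A x -> is_derive x v f ('D_v f x).
Proof. by move=> fs Ax; apply/derivableP/diff_derivable; exact: smooth_differentiable Ax. Qed.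

Lemma smooth_is_derive1 (W : normedModType R) (A : set R) (f : R -> W) (t : R) :
  smooth_on A f -> A t -> is_derive t 1 f (derive1 f t).
Proof. by move=> fs At; rewrite derive1E; exact: smooth_is_derive At. Qed.

Lemma is_derive1E (W : normedModType R) (f : R -> W) (t : R) d :
  is_derive t 1 f d -> derive1 f t = d.
Proof. by rewrite derive1E => -[_ ->]. Qed.

Lemma derive_dirZ (W : normedModType R) (f : R -> W) (t v : R) d :
  is_derive t 1 f d -> 'D_v f t = v *: d.
Proof.
move=> [fD <-]; have fd : differentiable f t by apply/derivable1_diffP.
by rewrite !deriveE // -linearZ /= [_ *: 1]mulr1.
Qed.

Section CrTheory.
Context {V : normedModType R}.
Variables (A : set V).
Hypothesis Ao : open A.

Lemma near_eq_on_open (W : Type) (f g : V -> W) x : (forall x, A x -> f x = g x) -> A x ->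
  \near x, f x = g x.
Proof. by move=> fg Ax; apply: filterS (open_nbhs_nbhs (conj Ao Ax)). Qed.

Lemma Cr_ext (W : normedModType R) r (f g : V -> W) : (forall x, A x -> f x = g x) ->
  Cr r A f -> Cr r A g.
Proof.
elim: r => [|r IH] in f g *; move=> fg.
  move=> fc x Ax; have fcx : f @ x --> f x := fc x Ax.
  change (g @ x --> g x); rewrite -(fg _ Ax); apply: cvg_trans fcx.
  by apply: near_eq_cvg; apply: near_eq_on_open => // y Ay; rewrite fg.
move=> [fD fDv]; split=> [x Ax|v].
  by apply: near_eq_differentiable (fD x Ax); exact: near_eq_on_open.
apply: IH (fDv v) => x Ax; apply: near_eq_derive; exact: near_eq_on_open.
Qed.

Lemma CrS (W : normedModType R) r (f : V -> W) : Cr r.+1 A f -> Cr r A f.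
Proof.
elim: r => [|r IH] in f *; first by move=> [fD _] x /fD /differentiable_continuous.
by move=> [fD fDv]; split=> // v; apply: IH; exact: fDv.
Qed.

Lemma Cr_cst (W : normedModType R) r (c : W) : Cr r A (fun=> c).
Proof.
elim: r => [|r IH] in c *; first by move=> x _; exact: cvg_cst.
split=> [x _|v]; first exact: differentiable_cst.
by apply: Cr_ext (IH 0) => x _; rewrite derive_cst.
Qed.

Lemma CrD (W : normedModType R) r (f g : V -> W) :
  Cr r A f -> Cr r A g -> Cr r A (fun x => f x + g x).
Proof.
elim: r => [|r IH] in f g *.
  by move=> fc gc x Ax; apply: cvgD; [exact: fc|exact: gc].
move=> [fD fDv] [gD gDv]; split=> [x Ax|v].
  by apply: differentiableD; [exact: fD|exact: gD].
apply: Cr_ext (IH _ _ (fDv v) (gDv v)) => x Ax.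
by rewrite deriveD //; apply: diff_derivable; [exact: fD|exact: gD].
Qed.

Lemma Cr_sum (W : normedModType R) r n (f : 'I_n -> V -> W) :
  (forall i, Cr r A (f i)) -> Cr r A (fun x => \sum_i f i x).
Proof.
elim: n => [|n IH] in f *; move=> fr.
  by apply: Cr_ext (Cr_cst r 0) => x _; rewrite big_ord0.
apply: Cr_ext (CrD (IH _ (fun i => fr (widen_ord (leqnSn n) i))) (fr ord_max)) => x _.
by rewrite big_ord_recr.
Qed.

Lemma Cr_lin (W W' : normedModType R) r (L : {linear W -> W'}) (f : V -> W) :
  continuous L -> Cr r A f -> Cr r A (fun x => L (f x)).
Proof.
move=> Lc; elim: r => [|r IH] in f *.
  by move=> fc x Ax; apply: (cvg_comp _ _ (fc x Ax)); exact: Lc.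
move=> [fD fDv]; split=> [x Ax|v].
  apply: (@differentiable_comp _ _ _ _ f L); first exact: fD.
  exact: linear_differentiable.
apply: Cr_ext (IH _ (fDv v)) => x Ax.
have /(is_derive_lin Lc) [_ ->] // : is_derive x v f ('D_v f x).
by apply/derivableP/diff_derivable; exact: fD.
Qed.

Lemma Cr_mxlin (W' : normedModType R) m n r (L : {linear 'M[R]_(m, n) -> W'})
    (f : V -> 'M[R]_(m, n)) :
  Cr r A f -> Cr r A (fun x => L (f x)).
Proof. by apply: Cr_lin; exact: mx_lin_continuous. Qed.

Lemma Cr_coord m n r (f : V -> 'M[R]_(m, n)) i j :
  Cr r A f -> Cr r A (fun x => f x i j).
Proof.
have @L : {linear 'M[R]_(m, n) -> R}.
  by exists (fun N : 'M[R]_(_, _) => N i j); do 2![eexists]; do ?[constructor];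
     rewrite ?mxE// => ? *; rewrite ?mxE//; move=> ?; rewrite !mxE.
exact: (@Cr_mxlin _ m n r L).
Qed.

Lemma Cr_id r : Cr r A id.
Proof.
case: r => [|r]; first by move=> x _; exact: cvg_id.
split=> [x _|v]; first by apply: (@linear_differentiable _ _ _ idfun) => y; exact: cvg_id.
by apply: Cr_ext (Cr_cst r v) => x _; rewrite derive_id.
Qed.

Lemma differentiable_fin_sum (W : normedModType R) n (f : 'I_n -> V -> W) x :
  (forall i, differentiable (f i) x) -> differentiable (fun y => \sum_i f i y) x.
Proof.
move=> fD; rewrite (_ : (fun y => _) = \sum_i f i); first exact: differentiable_sum.
by apply/funext => y; rewrite fct_sumE.
Qed.

Lemma differentiable_coordM m n (f : V -> 'M[R]_(m, n)) x i j :
  differentiable f x -> differentiable (fun y => f y i j) x.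
Proof.
move=> fD; apply: (@differentiable_comp _ _ _ _ f (fun M : 'M[R]_(m, n) => M i j)) => //.
exact: differentiable_coord.
Qed.

Lemma differentiable_mx m n (f : V -> 'M[R]_(m, n)) x :
  (forall i j, differentiable (fun y => f y i j) x) -> differentiable f x.
Proof.
move=> fD; rewrite (_ : f = fun y => \sum_i \sum_j f y i j *: delta_mx i j); last first.
  by apply/funext => y; exact: matrix_sum_delta.
apply: differentiable_fin_sum => i; apply: differentiable_fin_sum => j.
exact: differentiableZl.
Qed.

Lemma differentiable_mulmx m n p (f : V -> 'M[R]_(m, n)) (g : V -> 'M[R]_(n, p)) x :
  differentiable f x -> differentiable g x -> differentiable (fun y => f y *m g y) x.
Proof.
move=> fD gD; apply: differentiable_mx => i j.
rewrite (_ : (fun y => _) = fun y => \sum_k f y i k * g y k j); last first.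
  by apply/funext => y; rewrite mxE.
apply: differentiable_fin_sum => k.
by apply: differentiableM; apply: differentiable_coordM.
Qed.

Lemma cvg_mx (T : Type) (F : set_system T) {FF : Filter F} m n (f : T -> 'M[R]_(m, n))
    (l : 'M[R]_(m, n)) :
  (forall i j, f x i j @[x --> F] --> l i j) -> f x @[x --> F] --> l.
Proof.
move=> fl; rewrite (_ : f = fun x => \sum_i \sum_j f x i j *: delta_mx i j); last first.
  by apply/funext => x; exact: matrix_sum_delta.
rewrite [l]matrix_sum_delta.
by apply: cvg_fin_sum => i; apply: cvg_fin_sum => j; apply: cvgZr_tmp.
Qed.

(** The Leibniz rule expresses a directional derivative of the product through
    products in which one factor has lost a derivative and the other has been
    demoted from C^(r+1) to C^r. *)
Lemma Cr_mulmx m n p r (f : V -> 'M[R]_(m, n)) (g : V -> 'M[R]_(n, p)) :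
  Cr r A f -> Cr r A g -> Cr r A (fun x => f x *m g x).
Proof.
elim: r => [|r IH] in f g *.
  move=> fc gc x Ax; apply: (@cvg_mx _ (nbhs x)) => i j.
  rewrite mxE; under eq_fun do rewrite mxE.
  apply: (@cvg_fin_sum _ (nbhs x)) => k; apply: cvgM.
    have fcx : f @ x --> f x := fc x Ax.
    exact: (cvg_comp _ _ fcx (@coord_continuous R _ _ i k (f x))).
  have gcx : g @ x --> g x := gc x Ax.
  exact: (cvg_comp _ _ gcx (@coord_continuous R _ _ k j (g x))).
move=> fr gr; have [fD fDv] := fr; have [gD gDv] := gr.
split=> [x Ax|v].
  by apply: differentiable_mulmx; [exact: fD|exact: gD].
apply: Cr_ext (CrD (IH _ _ (fDv v) (CrS gr)) (IH _ _ (CrS fr) (gDv v))) => x Ax.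
have dF : is_derive x v f ('D_v f x) by apply/derivableP/diff_derivable; exact: fD.
have dG : is_derive x v g ('D_v g x) by apply/derivableP/diff_derivable; exact: gD.
by have [_ ->] := is_derive_mulmx dF dG.
Qed.

Lemma CrZ m n r c (f : V -> 'M[R]_(m, n)) : Cr r A f -> Cr r A (fun x => c *: f x).
Proof. exact: (@Cr_mxlin _ _ _ r ( *:%R c)). Qed.

Lemma CrB m n r (f g : V -> 'M[R]_(m, n)) :
  Cr r A f -> Cr r A g -> Cr r A (fun x => f x - g x).
Proof.
move=> fr gr; apply: CrD => //.
exact: (@Cr_mxlin _ _ _ r -%R).
Qed.

Lemma Cr_mxscale m n r (f : V -> R) (g : V -> 'M[R]_(m, n)) :
  Cr r A f -> Cr r A g -> Cr r A (fun x => f x *: g x).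
Proof.
move=> fr gr.
have lin1 : linear ( *:%R ^~ 1%:M : R -> 'M[R]_m).
  by move=> a b c; rewrite scalerDl scalerA.
pose lin1M := GRing.isLinear.Build _ _ _ _ _ lin1.
pose L : {linear R -> 'M[R]_m} := HB.pack ( *:%R ^~ 1%:M) lin1M.
have fr' : Cr r A (fun x => (f x)%:M : 'M[R]_m).
  apply: Cr_ext (@Cr_lin R _ r L f _ fr).
    by move=> x _ /=; rewrite scalemx1.
  exact: scalel_continuous.
by apply: Cr_ext (Cr_mulmx fr' gr) => x _; rewrite mul_scalar_mx.
Qed.

End CrTheory.
End Calculus.

(** * The matrix exponential *)

Section Expm.
Context {R : realType} {m : nat}.
Implicit Types (A : 'M[R]_m) (t : R).

Lemma coord_le_norm m1 m2 (B : 'M[R]_(m1, m2)) i j : `|B i j| <= `|B|.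
Proof. by rewrite [leRHS]/Num.norm /= mx_normrE; exact: (le_bigmax _ _ (i, j)). Qed.

Lemma expr_mx_bound A k i j : `|(A ^+ k) i j| <= (m%:R * `|A|) ^+ k.
Proof.
elim: k => [|k IH] in i j *.
  by rewrite expr0 mxE; case: (i == j); rewrite ?normr1 // normr0.
rewrite exprS -mulmxE mxE (le_trans (ler_norm_sum _ _ _)) //.
rewrite exprS -mulrA mulr_natl -[X in _ *+ X]card_ord -sumr_const.
apply: ler_sum => l _; rewrite normrM ler_pM //; exact: coord_le_norm.
Qed.

Definition expm_coef A s i j k := (k`!%:R)^-1 * (A ^+ (k + s)) i j.

Lemma cvg_expm_coef A s i j t : cvgn (pseries (expm_coef A s i j) t).
Proof.
(* The entrywise norm is submultiplicative only up to the factor m. *)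
set b := m%:R * `|A|.
have b0 : 0 <= b by rewrite mulr_ge0.
apply: normed_cvg.
apply: (@series_le_cvg _ _ (fun k => b ^+ s * exp_coeff (b * `|t|) k)).
- by move=> k; exact: normr_ge0.
- by move=> k; rewrite mulr_ge0 ?exprn_ge0 ?exp_coeff_ge0 // mulr_ge0.
- move=> k; rewrite /expm_coef /exp_coeff /= !normrM normrX normfV normr_nat.
  rewrite [leRHS](_ : _ = (k`!%:R)^-1 * b ^+ (k + s) * `|t| ^+ k).
    by rewrite ler_wpM2r ?exprn_ge0 // ler_wpM2l ?invr_ge0 // expr_mx_bound.
  by rewrite [(b * _) ^+ k]exprMn exprD; ring.
rewrite (_ : (fun k => _) = b ^+ s *: exp_coeff (b * `|t|)) //.
apply: is_cvg_seriesZ; exact: is_cvg_series_exp_coeff.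
Qed.

Lemma pseries_diffs_expm_coef A s i j :
  pseries_diffs (expm_coef A s i j) = expm_coef A s.+1 i j.
Proof.
apply/funext => k; rewrite /pseries_diffs /expm_coef mulrA factS natrM invfM.
by rewrite mulVKf ?addSnnS // pnatr_eq0.
Qed.

(** The sum of t^k A^(k+s) / k! over k, that is A^s exp(tA), taken entrywise: each
    entry is a real power series in t, and differentiating it raises s by one. *)
Definition expm_tail A s t : 'M[R]_m :=
  \matrix_(i, j) limn (pseries (expm_coef A s i j) t).

Lemma is_derive_expm_tail A s t :
  is_derive t 1 (expm_tail A s) (expm_tail A s.+1 t).
Proof.
apply: is_derive_mx => i j; rewrite mxE -pseries_diffs_expm_coef.
rewrite (_ : (fun y => _) = fun y => limn (pseries (expm_coef A s i j) y)); last first.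
  by apply/funext => y; rewrite mxE.
(* Any radius beyond |t| would do, as the series converges everywhere. *)
apply: (@pseries_snd_diffs R _ (`|t| + 1)).
- exact: cvg_expm_coef.
- by rewrite pseries_diffs_expm_coef; exact: cvg_expm_coef.
- by rewrite !pseries_diffs_expm_coef; exact: cvg_expm_coef.
- by rewrite (ger0_norm (_ : 0 <= `|t| + 1)) ?ltrDl // addr_ge0.
Qed.

Lemma cvg_expm_series A s t :
  series (fun k => (k`!%:R)^-1 *: (t ^+ k *: A ^+ (k + s))) @ \oo --> expm_tail A s t.
Proof.
apply: cvg_mx => i j; rewrite mxE.
have := @cvg_expm_coef A s i j t; rewrite /pseries.
apply: cvg_trans; apply: near_eq_cvg; near=> n => /=.
rewrite /series /= summxE; apply: eq_bigr => k _.
by rewrite /expm_coef !mxE; ring.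
Unshelve. all: by end_near. Qed.

Lemma expr_mxZ A t k : (t *: A) ^+ k = t ^+ k *: A ^+ k.
Proof.
elim: k => [|k IH]; first by rewrite !expr0 scale1r.
by rewrite !exprS -!mulmxE IH -scalemxAl -scalemxAr scalerA.
Qed.

Lemma expmE A t : expm (t *: A) = expm_tail A 0 t.
Proof.
apply: cvg_lim => //; have := @cvg_expm_series A 0 t.
rewrite (_ : (fun k => _) = fun k => (k`!%:R)^-1 *: (t *: A) ^+ k) //.
by apply/funext => k; rewrite expr_mxZ addn0.
Qed.

(** With L the multiplication by A on either side, this identifies A exp(tA) and
    exp(tA) A with the same series. *)
Lemma lin_series_expm A s t (L : {linear 'M[R]_m -> 'M[R]_m}) :
  series (fun k => (k`!%:R)^-1 *: (t ^+ k *: L (A ^+ (k + s)))) @ \oo -->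
  L (expm_tail A s t).
Proof.
have := cvg_comp _ _ (@cvg_expm_series A s t)
  (@mx_lin_continuous R _ _ _ L (expm_tail A s t)).
apply: cvg_trans; apply: near_eq_cvg; near=> n => /=.
rewrite /series /= linear_sum; apply: eq_bigr => k _.
by rewrite linearZ /= [X in _ *: X]linearZ.
Unshelve. all: by end_near. Qed.

Lemma mulmx_expm_tail A s t : A *m expm_tail A s t = expm_tail A s.+1 t.
Proof.
apply: (cvg_unique (@norm_hausdorff _ _) (lin_series_expm (L := mulmx A))).
rewrite (_ : (fun k => _) = (fun k => (k`!%:R)^-1 *: (t ^+ k *: A ^+ (k + s.+1)))).
  exact: cvg_expm_series.
by apply/funext => k /=; rewrite addnS exprS -mulmxE.
Qed.

Lemma expm_tail_mulmx A s t : expm_tail A s t *m A = expm_tail A s.+1 t.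
Proof.
apply: (cvg_unique (@norm_hausdorff _ _) (lin_series_expm (L := mulmxr A))).
rewrite (_ : (fun k => _) = (fun k => (k`!%:R)^-1 *: (t ^+ k *: A ^+ (k + s.+1)))).
  exact: cvg_expm_series.
by apply/funext => k /=; rewrite addnS exprSr -mulmxE.
Qed.

Lemma is_derive_expm A t :
  is_derive t 1 (fun s => expm (s *: A)) (A *m expm (t *: A)).
Proof.
rewrite expmE mulmx_expm_tail (_ : (fun s => _) = expm_tail A 0).
  exact: is_derive_expm_tail.
by apply/funext => s; rewrite expmE.
Qed.

Lemma expm_comm A t : A *m expm (t *: A) = expm (t *: A) *m A.
Proof. by rewrite expmE mulmx_expm_tail expm_tail_mulmx. Qed.

Lemma expm0 : expm 0 = 1%:M :> 'M[R]_m.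
Proof.
rewrite -(scale0r (0 : 'M[R]_m)) expmE; apply/matrixP => i j; rewrite mxE.
apply: cvg_lim => //; rewrite -cvg_shiftS; apply: cvg_near_cst; near=> n.
rewrite /pseries /series /= big_nat_recl // big1 ?addr0.
  by rewrite /expm_coef /= fact0 invr1 mul1r expr0 mulr1.
by move=> k _; rewrite expr0n /= mulr0.
Unshelve. all: by end_near. Qed.

Lemma expmNK A t : expm (t *: - A) *m expm (t *: A) = 1%:M.
Proof.
(* Constant, since A commutes with its exponential. *)
pose F s := expm (s *: - A) *m expm (s *: A).
have F0 : F 0 = 1%:M by rewrite /F !scale0r expm0 mulmx1.
rewrite -F0; apply: (@is_derive_mx_0_cst R _ _ setT F) => // s _.
apply: is_derive_eq; first by apply: is_derive_mulmx; exact: is_derive_expm.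
by rewrite expm_comm mulmxN mulNmx -mulmxA addNr.
Qed.

(** exp(-tA) X(t) has derivative zero. *)
Lemma linear_ode p (I : set R) A (X : R -> 'M[R]_(m, p)) :
  is_interval I -> I 0 -> (forall t : R, I t -> is_derive t 1 X (A *m X t)) ->
  forall t, I t -> X t = expm (t *: A) *m X 0.
Proof.
move=> Ii I0 XD t It.
pose F s := expm (s *: - A) *m X s.
have -> : X 0 = F t.
  rewrite -[X 0]mul1mx -expm0 -(scale0r (- A)) -/(F 0).
  apply: (is_derive_mx_0_cst Ii) => // s Is.
  apply: is_derive_eq.
    by apply: is_derive_mulmx; [exact: is_derive_expm|exact: XD].
  by rewrite expm_comm mulmxN mulNmx -mulmxA addNr.
by rewrite mulmxA -[X in expm (_ *: X)]opprK expmNK mul1mx.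
Qed.

End Expm.

(** Both sides solve X' = A X with the value g at 0. *)
Lemma expm_intertwine {R : realType} m p (A : 'M[R]_m) (B : 'M[R]_p) (g : 'M[R]_(m, p)) t :
  A *m g = g *m B -> expm (t *: A) *m g = g *m expm (t *: B).
Proof.
move=> AgB; pose X s := g *m expm (s *: B).
have X0 : X 0 = g by rewrite /X scale0r expm0 mulmx1.
rewrite -{1}X0; symmetry; apply: (@linear_ode R m p setT A X) => // s _.
rewrite /X mulmxA AgB -mulmxA.
apply: (@is_derive_mxlin R _ _ _ _ (mulmx g)); exact: is_derive_expm.
Qed.

(** g^+ g is constant along g(s) = exp(sA), because A is skew. *)
Lemma expm_Sp {R : realType} n (A : 'M[R]_(n + n)) t : sp A -> Sp n (expm (t *: A)).
Proof.
rewrite spE SpE => spA; pose F s := sadj (expm (s *: A)) *m expm (s *: A).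
have F0 : F 0 = 1%:M by rewrite /F !scale0r expm0 sadj1 mulmx1.
rewrite -F0; apply: (@is_derive_mx_0_cst R _ _ setT F) => // s _.
apply: is_derive_eq.
  apply: is_derive_mulmx; last exact: is_derive_expm.
  by apply: is_derive_mxlin; exact: is_derive_expm.
by rewrite /= sadjM spA mulmxN mulNmx mulmxA addNr.
Qed.

Lemma Cr_expm {R : realType} m r (I : set R) (A : 'M[R]_m) : open I ->
  Cr r I (fun t : R => expm (t *: A)).
Proof.
move=> Io; have FD (t : R) : differentiable (fun t : R => expm (t *: A)) t.
  by apply/derivable1_diffP; case: (is_derive_expm A t).
elim: r => [|r IH]; first by move=> t _; exact: differentiable_continuous.
split=> [t _|v]; first exact: FD.
have AIH : Cr r I (fun t : R => A *m expm (t *: A)).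
  by apply: (Cr_mulmx Io) => //; exact: (Cr_cst Io).
apply: (Cr_ext Io) (CrZ Io v AIH) => t _.
by rewrite (derive_dirZ _ (is_derive_expm A t)).
Qed.

(** * The Levi-Civita connection of SpSt *)

Section CrSymplectic.
Context {R : realType} {V : normedModType R}.
Variables (A : set V).
Hypothesis Ao : open A.

Lemma Cr_sadj a b r (f : V -> 'M[R]_(a + a, b + b)) :
  Cr r A f -> Cr r A (fun x => sadj (f x)).
Proof. exact: (@Cr_mxlin _ _ _ Ao _ _ _ r (@sadj R a b)). Qed.

Lemma Cr_halfproj n k r (f : V -> 'M[R]_(n + n, k + k)) :
  Cr r A f -> Cr r A (fun x => halfproj (f x)).
Proof.
move=> fr; apply: (CrB Ao); first exact: (Cr_cst Ao).
by apply: (CrZ Ao); apply: (Cr_mulmx Ao) => //; exact: Cr_sadj.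
Qed.

Lemma Cr_Omega_tilde n k r (f g : V -> 'M[R]_(n + n, k + k)) :
  Cr r A f -> Cr r A g -> Cr r A (fun x => Omega_tilde (f x) (g x)).
Proof.
move=> fr gr; have Sr : Cr r A (fun x => halfproj (f x) *m g x *m sadj (f x)).
  by do !apply: (Cr_mulmx Ao) => //; [exact: Cr_halfproj|exact: Cr_sadj].
apply: (Cr_ext Ao) (CrB Ao Sr (Cr_sadj Sr)) => x _.
by rewrite Omega_tilde_skew.
Qed.

Lemma Cr_h_SpSt n k r (f g g' : V -> 'M[R]_(n + n, k + k)) :
  Cr r A f -> Cr r A g -> Cr r A g' -> Cr r A (fun x => h_SpSt (f x) (g x) (g' x)).
Proof.
move=> fr gr gr'.
have Sr : Cr r A (fun x => sadj (g x) *m halfproj (f x) *m g' x).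
  by do !apply: (Cr_mulmx Ao) => //; [exact: Cr_sadj|exact: Cr_halfproj].
apply: (Cr_ext Ao) (@Cr_mxlin _ _ _ Ao R _ _ r (@mxtrace R (k + k)) _ Sr) => x _.
by rewrite h_SpStE.
Qed.

End CrSymplectic.

Section Geometry.
Context {R : realType} {n k : nat}.
Local Notation V := 'M[R]_(n + n, k + k).
Implicit Types (p v w : V) (A B : 'M[R]_(n + n)).

Lemma SpSt_mul A p : Sp n A -> SpSt n k p -> SpSt n k (A *m p).
Proof.
by rewrite SpE !SpStE sadjM => AS pS; rewrite -mulmxA (mulmxA (sadj A)) AS mul1mx.
Qed.

Lemma h_SpSt_is_linear p v : linear (h_SpSt p v).
Proof. by move=> a w w'; rewrite !h_SpStE linearP linearP. Qed.

HB.instance Definition _ p v := GRing.isLinear.Build R _ _ _ (@h_SpSt R n k p v)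
  (h_SpSt_is_linear p v).

(** Differentiate c^+ c = 1. *)
Lemma curve_tangent (c : R -> V) (t : R) dc : is_derive t 1 c dc ->
  (\near t, SpSt n k (c t)) -> tangent_SpSt (c t) dc.
Proof.
move=> cD cS; rewrite tangent_SpStE; apply/eqP; rewrite -addr_eq0; apply/eqP.
apply: (@derivative_unique _ _ _ (fun s => sadj (c s) *m c s) t 1).
  by apply: is_derive_mulmx => //; exact: is_derive_mxlin.
apply: (near_eq_is_derive (f := cst 1%:M)).
by apply: filterS cS => s; rewrite SpStE => ->.
Qed.

Lemma is_derive_Omega_tilde (c X : R -> V) (t : R) dc dX :
  is_derive t 1 c dc -> is_derive t 1 X dX ->
  exists2 dO, is_derive t 1 (fun s => Omega_tilde (c s) (X s)) dO & sp dO.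
Proof.
move=> cD XD.
have sD : is_derive t 1 (fun s => sadj (c s)) (sadj dc) by exact: is_derive_mxlin.
have PD : is_derive t 1 (fun s => halfproj (c s))
    (0 - 2^-1 *: (dc *m sadj (c t) + c t *m sadj dc)).
  apply: is_derive_sub.
  exact: (is_derive_mxlin ( *:%R 2^-1) (is_derive_mulmx cD sD)).
have [dS SD] : exists dS, is_derive t 1 (fun s => halfproj (c s) *m X s *m sadj (c s)) dS.
  by eexists; apply: is_derive_mulmx sD; exact: is_derive_mulmx PD XD.
exists (dS - sadj dS); last exact: sp_skew.
apply: is_derive_funext (is_derive_sub SD (is_derive_mxlin sadj SD)).
by apply/funext => s; rewrite Omega_tilde_skew.
Qed.

(** The correction turning flat differentiation into the Levi-Civita connection:
    the connection sends the pair of fields A q, B q, with A and B horizontal at p,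
    to half the bracket of the two fields, while the flat derivative is B A p. *)
Definition christoffel p v w : V := - 2^-1 *: ((Omega_tilde p v *m Omega_tilde p w
  + Omega_tilde p w *m Omega_tilde p v) *m p).

Lemma christoffel_sym p v w : christoffel p v w = christoffel p w v.
Proof. by rewrite /christoffel addrC. Qed.

Lemma christoffel_is_linear p v : linear (christoffel p v).
Proof.
move=> a w w'; rewrite /christoffel Omega_tilde_is_linear.
move: (Omega_tilde p v) (Omega_tilde p w) (Omega_tilde p w') => A B C.
have -> : A *m (a *: B + C) + (a *: B + C) *m A = a *: (A *m B + B *m A) + (A *m C + C *m A).
  by rewrite mulmxDr mulmxDl -scalemxAr -scalemxAl scalerDr addrACA.
move: (A *m B + B *m A) (A *m C + C *m A) => AB AC.
by rewrite mulmxDl -scalemxAl scalerDr !scalerA [_ * a]mulrC.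
Qed.

HB.instance Definition _ p v := GRing.isLinear.Build R _ _ _ (christoffel p v)
  (christoffel_is_linear p v).

(** Near t the field is X = B c with B(s) = Omega_tilde(c(s),X(s)), so that
    X' = B' c + B A c; the Christoffel term replaces B A by the bracket [B,A]/2.
    Both B' and the bracket lie in sp(2n), so the result is tangent. *)
Lemma curve_covariant (c X : R -> V) (t : R) dc dX :
  is_derive t 1 c dc -> is_derive t 1 X dX ->
  (\near t, SpSt n k (c t)) -> (\near t, tangent_SpSt (c t) (X t)) ->
  exists dO, [/\ is_derive t 1 (fun s => Omega_tilde (c s) (X s)) dO, sp dO &
    let A := Omega_tilde (c t) dc in let B := Omega_tilde (c t) (X t) in
    dX + christoffel (c t) dc (X t) = (dO + 2^-1 *: (B *m A - A *m B)) *m c t].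
Proof.
move=> cD XD cS XT; have [dO OD spO] := is_derive_Omega_tilde cD XD.
exists dO; split=> // A B.
have cSt := nbhs_singleton cS; have XTt := nbhs_singleton XT.
have dcE : dc = A *m c t by rewrite Omega_tilde_id //; exact: curve_tangent.
have -> : dX = dO *m c t + B *m dc.
  apply: (derivative_unique XD); apply: near_eq_is_derive (is_derive_mulmx OD cD).
  by apply: filterS2 cS XT => s cSs XTs; rewrite Omega_tilde_id.
rewrite [RHS]mulmxDl -addrA; congr (_ + _).
rewrite /christoffel -/A -/B; clearbody A B.
rewrite [X in B *m X]dcE mulmxA -scalemxAl mulmxDl mulmxBl.
move: (B *m A *m c t) (A *m B *m c t) => x y.
by rewrite scaleNr scalerDr scalerBr -{1}(scale_half2 x) opprD [X in _ + X]addrC addrA addrK.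
Qed.

(** h(X,Z) = - tr (B C) / 2 with B and C the matrices of X and Z.  The derivative
    of the right-hand side produces B' and C'; the two bracket terms of the
    covariant derivatives cancel because the trace form is invariant under
    the adjoint action of A. *)
Lemma curve_metric (c X Z : R -> V) (t : R) dc dX dZ :
  is_derive t 1 c dc -> is_derive t 1 X dX -> is_derive t 1 Z dZ ->
  (\near t, SpSt n k (c t)) -> (\near t, tangent_SpSt (c t) (X t)) ->
  (\near t, tangent_SpSt (c t) (Z t)) ->
  is_derive t 1 (fun s => h_SpSt (c s) (X s) (Z s))
    (h_SpSt (c t) (dX + christoffel (c t) dc (X t)) (Z t) +
     h_SpSt (c t) (X t) (dZ + christoffel (c t) dc (Z t))).
Proof.
move=> cD XD ZD cS XT ZT.
have [dO [OD spO ->]] := curve_covariant cD XD cS XT.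
have [dO' [OD' spO' ->]] := curve_covariant cD ZD cS ZT.
set A := Omega_tilde (c t) dc; set B := Omega_tilde _ _; set C := Omega_tilde _ _.
have spx M N : sp (2^-1 *: (Omega_tilde (c t) M *m Omega_tilde (c t) N -
    Omega_tilde (c t) N *m Omega_tilde (c t) M)).
  by apply/spZ/sp_bracket; exact: sp_Omega_tilde.
rewrite h_SpSt_sym !h_SpSt_sp; try by apply: spD => //; exact: spx.
pose F s := \tr (- 2^-1 *: (Omega_tilde (c s) (X s) *m Omega_tilde (c s) (Z s))).
have FD : is_derive t 1 F (\tr (- 2^-1 *: (dO *m C + B *m dO'))).
  apply: (@is_derive_mxlin R _ R _ _ (@mxtrace R (n + n))).
  exact: (is_derive_mxlin ( *:%R (- 2^-1)) (is_derive_mulmx OD OD')).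
have FE : \near t, F t = h_SpSt (c t) (X t) (Z t).
  apply: filterS2 cS ZT => s cSs ZTs; rewrite /F mxtraceZ.
  rewrite -[in RHS](Omega_tilde_id cSs ZTs) h_SpSt_sp //; exact: sp_Omega_tilde.
apply: near_eq_is_derive FE _; apply: (is_derive_eq FD).
rewrite mxtraceZ -mulrDr -/B -/C; congr (_ * _).
clearbody A B C.
rewrite !mulmxDr !mxtraceD -!scalemxAr !mxtraceZ !mulmxBr !linearB /=.
rewrite [\tr (C *m dO)]mxtrace_mulC !mulmxA.
rewrite [\tr (C *m B *m A)]mxtrace_mulC mulmxA.
rewrite [\tr (C *m A *m B)]mxtrace_mulC mulmxA.
by rewrite [\tr (A *m C *m B)]mxtrace_mulC mulmxA; ring.
Qed.

(** Every tangent vector is the velocity of a curve that stays in the manifold, so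
    that derivatives of ambient extensions along tangent directions depend only
    on the values on the manifold. *)
Lemma curve_through p v : SpSt n k p -> tangent_SpSt p v ->
  exists c : R -> V, [/\ forall s, SpSt n k (c s), c 0 = p & is_derive (0 : R) 1 c v].
Proof.
move=> pS pv; exists (fun s => expm (s *: Omega_tilde p v) *m p); split.
- by move=> s; apply: SpSt_mul => //; apply: expm_Sp; exact: sp_Omega_tilde.
- by rewrite scale0r expm0 mul1mx.
- apply: is_derive_eq.
    apply: (is_derive_mxlin (mulmxr p)); exact: is_derive_expm.
  by rewrite /= scale0r expm0 mulmx1 Omega_tilde_id.
Qed.

Local Notation field := (vector_field (SpSt n k) (@tangent_SpSt R n k)).

Lemma Cr_christoffel (V' : normedModType R) (A : set V') (f g h : V' -> V) r : open A ->
  Cr r A f -> Cr r A g -> Cr r A h ->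
  Cr r A (fun x => christoffel (f x) (g x) (h x)).
Proof.
move=> Ao fr gr hr; have Or f' : Cr r A f' -> Cr r A (fun x => Omega_tilde (f x) (f' x)).
  by move=> ?; exact: Cr_Omega_tilde.
apply: (CrZ Ao); apply: (Cr_mulmx Ao) => //.
by apply: (CrD Ao); apply: (Cr_mulmx Ao); exact: Or.
Qed.

(** The direction varies with the point: expand it in the elementary matrices to
    get smooth coefficients times derivatives in fixed directions. *)
Lemma smooth_derive_along (X Y : V -> V) :
  smooth_on setT X -> smooth_on setT Y -> smooth_on setT (fun p => 'D_(X p) Y p).
Proof.
move=> Xs Ys r; have To : open [set: V] by exact: openT.
have DYs v : Cr r setT (fun p => 'D_v Y p) by have [_] := Ys r.+1; apply.
apply: (Cr_ext To (f := fun p => \sum_i \sum_j X p i j *: 'D_(delta_mx i j) Y p)).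
  move=> p _; have YD : differentiable Y p by exact: smooth_differentiable Ys _.
  rewrite deriveE // [in RHS](matrix_sum_delta (X p)) linear_sum.
  apply: eq_bigr => i _; rewrite linear_sum; apply: eq_bigr => j _.
  by rewrite linearZ /= deriveE.
apply: (Cr_sum To) => i; apply: (Cr_sum To) => j.
by apply: (Cr_mxscale To) => //; apply: (Cr_coord To); exact: Xs.
Qed.

Definition SpSt_nabla p v (Y : V -> V) : V := 'D_v Y p + christoffel p v (Y p).

Lemma is_derive_along_curve (c : R -> V) (t : R) dc (Y : V -> V) : 
  smooth_on setT Y -> is_derive t 1 c dc ->
  is_derive t 1 (fun s => Y (c s)) ('D_dc Y (c t)).
Proof. by move=> Ys cD; apply: is_derive_comp => //; exact: smooth_differentiable Ys _. Qed.

Lemma near_forall (P : R -> Prop) (t : R) : (forall s, P s) -> \near t, P t.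
Proof. by move=> Ps; near=> s. Unshelve. all: by end_near. Qed.

Lemma SpSt_levi_civita :
  levi_civita (SpSt n k) (@tangent_SpSt R n k) (@h_SpSt R n k) SpSt_nabla.
Proof.
split; [split| |].
- move=> p v Y Y' pS pv [Ys _] [Ys' _] YY'.
  have [c [cS c0 cD]] := curve_through pS pv.
  rewrite /SpSt_nabla (YY' p pS); congr (_ + _).
  have Yc := is_derive_along_curve Ys cD; have Yc' := is_derive_along_curve Ys' cD.
  rewrite -c0; apply: (derivative_unique Yc).
  by rewrite (_ : (fun s => Y (c s)) = fun s => Y' (c s)) //; apply/funext => s; rewrite YY'.
- move=> X Y [Xs XT] [Ys YT]; exists (fun p => SpSt_nabla p (X p) Y) => //; split.
    move=> r; apply: (CrD openT); first exact: (smooth_derive_along Xs Ys r).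
    by apply: (Cr_christoffel openT); [exact: (Cr_id openT)|exact: Xs|exact: Ys].
  move=> p pS; have [c [cS c0 cD]] := curve_through pS (XT p pS).
  have Yc := is_derive_along_curve Ys cD.
  have [| |dO [_ spO /= E]] := curve_covariant cD Yc.
  + by apply: near_forall => s; exact: cS.
  + by apply: near_forall => s; exact: YT.
  rewrite /SpSt_nabla -c0 in E *; rewrite E; apply: tangent_SpSt_sp.
  by apply: spD => //; apply/spZ/sp_bracket; exact: sp_Omega_tilde.
- move=> p a v w Y pS pv pw [Ys _]; rewrite /SpSt_nabla.
  have YD : differentiable Y p by exact: smooth_differentiable Ys _.
  rewrite !deriveE // linearP /= scalerDr !(christoffel_sym p _ (Y p)).
  by rewrite christoffel_is_linear addrACA.
- move=> p v Y Z pS pv [Ys _] [Zs _]; rewrite /SpSt_nabla.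
  have YD := smooth_is_derive v Ys (I : setT p).
  have ZD := smooth_is_derive v Zs (I : setT p).
  by have [_ ->] := is_derive_add YD ZD; rewrite linearD addrACA.
- move=> p v f Y pS pv fs [Ys _]; rewrite /SpSt_nabla.
  have YD := smooth_is_derive v Ys (I : setT p).
  have fD := smooth_is_derive v fs (I : setT p).
  by have [_ ->] := is_derive_mxscale fD YD; rewrite linearZ /= scalerDr addrA.
- move=> p X Y pS _ _; rewrite /SpSt_nabla (christoffel_sym p (X p)) opprD.
  by rewrite addrACA subrr addr0.
- move=> p v Y Z pS pv [Ys YT] [Zs ZT].
  have [c [cS c0 cD]] := curve_through pS pv.
  have Fs : smooth_on setT (fun q => h_SpSt q (Y q) (Z q)).
    by move=> r; apply: (Cr_h_SpSt openT); [exact: (Cr_id openT)|exact: Ys|exact: Zs].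
  rewrite /SpSt_nabla -c0.
  have FD : is_derive (0 : R) 1 (fun s => h_SpSt (c s) (Y (c s)) (Z (c s)))
      ('D_v (fun q => h_SpSt q (Y q) (Z q)) (c 0)).
    by apply: (is_derive_comp cD); exact: smooth_differentiable Fs _.
  apply: (derivative_unique FD).
  apply: (curve_metric cD (is_derive_along_curve Ys cD) (is_derive_along_curve Zs cD)).
  + by apply: near_forall => s; exact: cS.
  + by apply: near_forall => s; exact: YT.
  + by apply: near_forall => s; exact: ZT.
Qed.

Section Along.
Variables (I : set R) (c : R -> V).
Hypotheses (Io : open I) (cs : smooth_on I c) (cS : forall t, I t -> SpSt n k (c t)).

Definition SpSt_cov (X : R -> V) (t : R) : V :=
  derive1 X t + christoffel (c t) (derive1 c t) (X t).

Lemma smooth_derive1 (X : R -> V) : smooth_on I X -> smooth_on I (derive1 X).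
Proof.
move=> Xs r; have [_ /(_ 1)] := Xs r.+1; apply: (Cr_ext Io) => t _.
by rewrite derive1E.
Qed.

Lemma derive1_tangent t : I t -> tangent_SpSt (c t) (derive1 c t).
Proof.
move=> It; apply: curve_tangent (smooth_is_derive1 cs It) _.
by apply: filterS (open_nbhs_nbhs (conj Io It)).
Qed.

Lemma SpSt_cov_along : covariant_derivative_along (SpSt n k) (@tangent_SpSt R n k)
  SpSt_nabla I c SpSt_cov.
Proof.
have near_I P t : (forall s, I s -> P s) -> I t -> \near t, P t.
  by move=> IP It; apply: filterS (open_nbhs_nbhs (conj Io It)).
split.
- move=> X Y [Xs _] [Ys _] XY t It; rewrite /SpSt_cov (XY t It); congr (_ + _).
  by rewrite !derive1E; apply: near_eq_derive; exact: near_I.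
- move=> X [Xs XT]; split.
    move=> r; apply: (CrD Io); first exact: (smooth_derive1 Xs r).
    by apply: (Cr_christoffel Io); [exact: cs|exact: (smooth_derive1 cs r)|exact: Xs].
  move=> t It; have cD := smooth_is_derive1 cs It; have XD := smooth_is_derive1 Xs It.
  have [||dO [_ spO /= E]] := curve_covariant cD XD.
  + by apply: near_I => // s; auto.
  + by apply: near_I => // s; auto.
  rewrite /SpSt_cov E; apply: tangent_SpSt_sp.
  by apply: spD => //; apply/spZ/sp_bracket; exact: sp_Omega_tilde.
- move=> X Y [Xs _] [Ys _] t It; rewrite /SpSt_cov.
  have XD := smooth_is_derive1 Xs It; have YD := smooth_is_derive1 Ys It.
  rewrite (is_derive1E (is_derive_add XD YD)).
  by rewrite linearD addrACA.
- move=> f X fs [Xs _] t It; rewrite /SpSt_cov.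
  have fD := smooth_is_derive1 fs It; have XD := smooth_is_derive1 Xs It.
  rewrite (is_derive1E (is_derive_mxscale fD XD)).
  by rewrite linearZ /= scalerDr addrA.
- move=> Y [Ys _] t It; rewrite /SpSt_cov /SpSt_nabla.
  by rewrite (is_derive1E (is_derive_along_curve Ys (smooth_is_derive1 cs It))).
Qed.

End Along.
End Geometry.

(** * Conservation of momentum along geodesics *)

Section Noether.
Context {R : realType} {n k : nat}.
Local Notation V := 'M[R]_(n + n, k + k).
Local Notation T := (@tangent_SpSt R n k).
Local Notation field := (vector_field (SpSt n k) T).
Implicit Types (p v w : V) (A B : 'M[R]_(n + n)).

Lemma killing_field A : sp A -> field (mulmx A).
Proof.
move=> spA; split=> [r|p pS]; last exact: tangent_SpSt_sp.
by apply: (Cr_mulmx openT); [exact: (Cr_cst openT)|exact: (Cr_id openT)].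
Qed.

Lemma is_derive_mulmxl A p v : is_derive p v (mulmx A : V -> V) (A *m v).
Proof. exact: (is_derive_mxlin (mulmx A) (is_derive_id p v)). Qed.

Lemma h_SpSt_invariant A p v w : Sp n A ->
  h_SpSt (A *m p) (A *m v) (A *m w) = h_SpSt p v w.
Proof.
move=> AS; rewrite !h_SpStE /halfproj.
have -> : 1%:M - 2^-1 *: (A *m p *m sadj (A *m p)) =
    A *m (1%:M - 2^-1 *: (p *m sadj p)) *m sadj A.
  rewrite mulmxBr mulmxBl mulmx1 (Sp_mulmxV AS) sadjM.
  by rewrite -scalemxAr -scalemxAl !mulmxA.
by rewrite sadjM -!mulmxA !(SpK _ AS) !mulmxA.
Qed.

(** Infinitesimal isometry, tested along g(s) p with g(s) = exp(sA): moving g(s)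
    across the metric replaces B by the conjugate g(s)^-1 B g(s), whose
    derivative at 0 is the bracket B A - A B. *)
Lemma derive_h_killing A B p : sp A ->
  'D_(A *m p) (fun q => h_SpSt q (B *m q) (B *m q)) p =
  2 * h_SpSt p (B *m p) ((B *m A - A *m B) *m p).
Proof.
move=> spA; pose g (s : R) := expm (s *: A).
have g0 : g 0 = 1%:M by rewrite /g scale0r expm0.
have gS s : Sp n (g s) by exact: expm_Sp.
have gD : is_derive (0 : R) 1 g A by have := is_derive_expm A 0; rewrite -/(g 0) g0 mulmx1.
have hs : smooth_on setT (fun q : V => h_SpSt q (B *m q) (B *m q)).
  have Bs : smooth_on setT (fun q : V => B *m q).
    by move=> r; apply: (Cr_mulmx openT); [exact: (Cr_cst openT)|exact: (Cr_id openT)].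
  by move=> r; apply: (Cr_h_SpSt openT); [exact: (Cr_id openT)|exact: Bs|exact: Bs].
have cD : is_derive (0 : R) 1 (fun s => g s *m p) (A *m p).
  exact: (is_derive_mxlin (mulmxr p) gD).
have c0 : g 0 *m p = p by rewrite g0 mul1mx.
have FD := is_derive_comp cD (smooth_differentiable (x := _) hs I).
rewrite c0 in FD; apply: (derivative_unique FD).
(* By invariance of h, only this vector at the fixed point p varies with s. *)
pose X s := sadj (g s) *m B *m g s *m p.
have XD : is_derive (0 : R) 1 X ((B *m A - A *m B) *m p).
  have sD : is_derive (0 : R) 1 (fun s => sadj (g s)) (- A).
    by move: spA; rewrite spE => <-; exact: is_derive_mxlin.
  apply: is_derive_eq.
    apply: (is_derive_mxlin (mulmxr p)); apply: (is_derive_mulmx _ gD).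
    exact: (is_derive_mxlin (mulmxr B) sD).
  by rewrite /= g0 sadj1 mul1mx mulmx1 mulNmx addrC.
have X0 : X 0 = B *m p by rewrite /X g0 sadj1 mul1mx mulmx1.
pose F s := \tr (sadj (X s) *m halfproj p *m X s).
have FE : (fun s => h_SpSt (g s *m p) (B *m (g s *m p)) (B *m (g s *m p))) = F.
  apply/funext => s; rewrite /F -h_SpStE.
  have -> : B *m (g s *m p) = g s *m X s.
    by rewrite /X !mulmxA (Sp_mulmxV (gS s)) mul1mx.
  exact: h_SpSt_invariant.
rewrite FE; apply: is_derive_eq.
  apply: (@is_derive_mxlin R _ R _ _ (@mxtrace R (k + k))).
  apply: (is_derive_mulmx _ XD).
  by apply: (is_derive_mxlin (mulmxr (halfproj p))); apply: (is_derive_mxlin sadj XD).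
by rewrite /= X0 linearD /= -!h_SpStE h_SpSt_sym mulr_natl mulr2n.
Qed.

Section Connection.
Variable nabla : V -> V -> (V -> V) -> V.
Hypothesis LC : levi_civita (SpSt n k) T (@h_SpSt R n k) nabla.

(** Extend v to the Killing field B q with B = Omega_tilde(p,v).  The torsion
    identity exchanges nabla_v (A q) for nabla_(A p) (B q) up to a bracket; metric
    compatibility turns the latter into half the derivative of h(B q, B q) along
    A p, which [derive_h_killing] shows to cancel the bracket. *)
Lemma killing_equation A p v : sp A -> SpSt n k p -> T p v ->
  h_SpSt p v (nabla p v (mulmx A)) = 0.
Proof.
have [_ tf mc] := LC => spA pS pv.
pose B := Omega_tilde p v; have spB : sp B by exact: sp_Omega_tilde.
have vE : v = B *m p by rewrite Omega_tilde_id.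
have fA := killing_field spA; have fB := killing_field spB.
have := tf _ _ _ pS fB fA.
have [_ ->] := is_derive_mulmxl A p (B *m p).
have [_ ->] := is_derive_mulmxl B p (A *m p).
rewrite -vE => /eqP; rewrite subr_eq => /eqP ->.
have Ap : T p (A *m p) by exact: fA.2.
have := mc _ _ _ _ pS Ap fB fB.
rewrite derive_h_killing // -vE [X in _ = X + _]h_SpSt_sym -mulr2n mulr_natl.
move=> /eqP; rewrite eqr_pMn2r // => /eqP E.
rewrite linearD /= -E -linearD /= [X in A *m X]vE; clearbody B.
by rewrite mulmxBl !mulmxA addrC addrA subrK subrr linear0.
Qed.

Section Geodesic.
Variables (I : set R) (c : R -> V) (D : (R -> V) -> (R -> V)).
Hypotheses (Io : open I) (cs : smooth_on I c) (cS : forall t, I t -> SpSt n k (c t)).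
Hypothesis DC : covariant_derivative_along (SpSt n k) T nabla I c D.

Local Notation along := (field_along T I c).

Lemma velocity_along : along (derive1 c).
Proof. by split; [exact: smooth_derive1|exact: derive1_tangent]. Qed.

Lemma zero_along : along (fun=> 0).
Proof.
split=> [r|t It]; first exact: (Cr_cst Io).
by rewrite tangent_SpStE linear0 mul0mx mulmx0 oppr0.
Qed.

Lemma add_along X Y : along X -> along Y -> along (fun s => X s + Y s).
Proof.
move=> [Xs XT] [Ys YT]; split=> [r|t It].
  by apply: (CrD Io); [exact: Xs|exact: Ys].
have := XT t It; have := YT t It; rewrite !tangent_SpStE => YE XE.
by rewrite sadjD mulmxDl mulmxDr opprD XE YE.
Qed.

Lemma scale_along (f : R -> R) X : smooth_on I f -> along X -> along (fun s => f s *: X s).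
Proof.
move=> fs [Xs XT]; split=> [r|t It].
  by apply: (Cr_mxscale Io); [exact: fs|exact: Xs].
have := XT t It; rewrite !tangent_SpStE => XE.
by rewrite sadjZ -scalemxAl -scalemxAr XE scalerN.
Qed.

Lemma killing_along A : sp A -> along (fun s => A *m c s).
Proof.
move=> spA; split=> [r|t It]; last by apply: tangent_SpSt_sp.
by apply: (Cr_mulmx Io); [exact: (Cr_cst Io)|exact: cs].
Qed.

Lemma sum_along (J : Type) (r : seq J) (X : J -> R -> V) :
  (forall j, along (X j)) -> along (fun s => \sum_(j <- r) X j s).
Proof.
move=> XT; elim: r => [|j r IH].
  rewrite (_ : (fun s => _) = fun=> 0); first exact: zero_along.
  by apply/funext => s; rewrite big_nil.
rewrite (_ : (fun s => _) = fun s => X j s + \sum_(j <- r) X j s); first exact: add_along.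
by apply/funext => s; rewrite big_cons.
Qed.

Lemma cov_sum (J : Type) (r : seq J) (X : J -> R -> V) : (forall j, along (X j)) ->
  forall t, I t -> D (fun s => \sum_(j <- r) X j s) t = \sum_(j <- r) D (X j) t.
Proof.
move=> XT; elim: r => [|j r IH] t It.
  rewrite big_nil; under eq_fun do rewrite big_nil.
  have := cov_add DC zero_along zero_along It; under eq_fun do rewrite addr0.
  by move=> /eqP; rewrite -{1}[D _ t]addr0 (inj_eq (addrI _)) => /eqP <-.
rewrite big_cons -IH // -(cov_add DC) //; last exact: sum_along.
by under eq_fun do rewrite big_cons.
Qed.

Definition skew_delta (ij : 'I_(n + n) * 'I_(n + n)) : 'M[R]_(n + n) :=
  2^-1 *: (delta_mx ij.1 ij.2 - sadj (delta_mx ij.1 ij.2)).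

Lemma sp_skew_delta ij : sp (skew_delta ij).
Proof. by apply: spZ; exact: sp_skew. Qed.

(** The skew parts of the elementary matrices span sp(2n), so their Killing fields
    form a global frame; it has too many elements, but the coordinates used
    here, the entries of Omega_tilde, depend smoothly on the vector. *)
Lemma skew_delta_sum A : sp A -> A = \sum_ij A ij.1 ij.2 *: skew_delta ij.
Proof.
move=> spA; rewrite [LHS](sp_half spA) {1 2}[A]matrix_sum_delta.
rewrite pair_bigA /= linear_sum /= -sumrB scaler_sumr; apply: eq_bigr => ij _.
by rewrite sadjZ -scalerBr !scalerA mulrC.
Qed.

(** Noether's theorem.  The axioms of a covariant derivative along c only speak
    of restrictions of ambient fields, so the velocity is written in the frame of
    Killing fields K_ij with smooth coefficients a_ij.  The derivative of
    h(c', A c) then regroups as h(D c', A c) + h(c', nabla_(c') (A q)): the first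
    term vanishes for a geodesic, the second by the Killing equation. *)
Lemma derive_killing_momentum A t : sp A -> I t -> D (derive1 c) t = 0 ->
  is_derive t 1 (fun s => h_SpSt (c s) (derive1 c s) (A *m c s)) 0.
Proof.
move=> spA It Dc.
pose th s := Omega_tilde (c s) (derive1 c s).
pose a ij s := th s ij.1 ij.2.
have as_ ij : smooth_on I (a ij).
  move=> r; apply: (Cr_coord Io); apply: (Cr_Omega_tilde Io); first exact: cs.
  exact: (smooth_derive1 Io cs r).
pose K ij s := skew_delta ij *m c s.
have KT ij : along (K ij) by apply: killing_along; exact: sp_skew_delta.
have aKT ij : along (fun s => a ij s *: K ij s) by exact: scale_along.
have velE s : I s -> derive1 c s = \sum_ij a ij s *: K ij s.
  move=> Is; have spt : sp (th s) by exact: sp_Omega_tilde.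
  have vE : th s *m c s = derive1 c s.
    by apply: Omega_tilde_id; [exact: cS|exact: (derive1_tangent Io cs cS Is)].
  rewrite -[LHS]vE [X in X *m _](skew_delta_sum spt) mulmx_suml.
  by apply: eq_bigr => ij _; rewrite -scalemxAl.
have DvE : D (derive1 c) t = \sum_ij D (fun s => a ij s *: K ij s) t.
  rewrite -(cov_sum _ aKT It).
  exact: (cov_ext DC velocity_along (sum_along _ aKT) velE It).
have DE : \sum_ij (derive1 (a ij) t *: K ij t +
    a ij t *: nabla (c t) (derive1 c t) (mulmx (skew_delta ij))) = 0.
  rewrite -[RHS]Dc DvE; apply: eq_bigr => ij _; rewrite (cov_leibniz DC (as_ ij) (KT ij) It).
  by rewrite (cov_restr DC (killing_field (sp_skew_delta ij)) It).
have [_ _ mc] := LC.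
have vT := derive1_tangent Io cs cS It.
have cD := smooth_is_derive1 cs It.
have fA := killing_field spA.
have hD ij : is_derive t 1 (fun s => h_SpSt (c s) (K ij s) (A *m c s))
    (h_SpSt (c t) (nabla (c t) (derive1 c t) (mulmx (skew_delta ij))) (A *m c t) +
     h_SpSt (c t) (K ij t) (nabla (c t) (derive1 c t) (mulmx A))).
  have fij := killing_field (sp_skew_delta ij).
  rewrite -(mc _ _ _ _ (cS It) vT fij fA).
  have hs : smooth_on setT (fun q : V => h_SpSt q (skew_delta ij *m q) (A *m q)).
    move=> r; apply: (Cr_h_SpSt openT); first exact: (Cr_id openT).
      exact: fij.1.
    exact: fA.1.
  by apply: (is_derive_comp cD); exact: smooth_differentiable hs _.
pose m s := \sum_ij a ij s * h_SpSt (c s) (K ij s) (A *m c s).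
have mD : is_derive t 1 m
    (\sum_ij (derive1 (a ij) t * h_SpSt (c t) (K ij t) (A *m c t) +
      a ij t * (h_SpSt (c t) (nabla (c t) (derive1 c t) (mulmx (skew_delta ij))) (A *m c t) +
     h_SpSt (c t) (K ij t) (nabla (c t) (derive1 c t) (mulmx A))))).
  apply: is_derive_fin_sum => ij.
  apply: is_derive_eq; first by apply: (is_deriveM (smooth_is_derive1 (as_ ij) It) (hD ij)).
  by rewrite addrC /GRing.scale /= [h_SpSt _ _ _ * _]mulrC.
apply: (near_eq_is_derive (f := m)).
  apply: filterS (open_nbhs_nbhs (conj Io It)) => s Is; rewrite /m.
  rewrite velE // h_SpSt_sym linear_sum; apply: eq_bigr => ij _.
  by rewrite linearZ /= h_SpSt_sym.
apply: (is_derive_eq mD).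
(* The zero is the acceleration, kept to be expanded in the frame. *)
transitivity (h_SpSt (c t) (A *m c t) 0 +
    h_SpSt (c t) (derive1 c t) (nabla (c t) (derive1 c t) (mulmx A))); last first.
  by rewrite linear0 add0r; exact: (killing_equation spA (cS It) vT).
rewrite -DE; set N := nabla _ _ (mulmx A).
rewrite linear_sum /= [X in _ + X]h_SpSt_sym [in X in _ + X]velE // linear_sum -big_split.
apply: eq_bigr => ij _ /=.
move: (A *m c t) N (nabla _ _ _) (K ij t) => x y z w.
rewrite linearD /= 3!linearZ /= !(h_SpSt_sym _ _ x) (h_SpSt_sym _ _ y).
by rewrite /GRing.scale /= mulrDr addrA.
Qed.

End Geodesic.
End Connection.
End Noether.

(** * Geodesics and horizontal lifts *)

Section Geodesics.
Context {R : realType} {n k : nat}.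
Local Notation V := 'M[R]_(n + n, k + k).
Local Notation T := (@tangent_SpSt R n k).
Implicit Types (U D : V) (M Z X : 'M[R]_(n + n)).

(** All momenta being constant, so is the matrix Omega_tilde(c,c') by
    nondegeneracy, and c solves a linear equation. *)
Lemma geodesic_expm (I : set R) (c : R -> V) : open I -> is_interval I -> I 0 ->
  is_geodesic (SpSt n k) T (@h_SpSt R n k) I c ->
  forall t, I t -> c t = expm (t *: Omega_tilde (c 0) (derive1 c 0)) *m c 0.
Proof.
move=> Io Ii I0 [cs cS [nabla LC [D DC D0]]].
pose th t := Omega_tilde (c t) (derive1 c t).
have spth t : sp (th t) by exact: sp_Omega_tilde.
have thE t : I t -> th t = th 0.
  move=> It; apply/eqP; rewrite -subr_eq0; apply/eqP; apply: sp_nondeg.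
    by apply: spD => //; exact: spN.
  move=> A spA; rewrite mulmxBl linearB /=; apply/eqP; rewrite subr_eq0; apply/eqP.
  have half_neq0 : - 2^-1 != 0 :> R by rewrite oppr_eq0 invr_eq0 pnatr_eq0.
  have momE s : - 2^-1 * \tr (th s *m A) = h_SpSt (c s) (derive1 c s) (A *m c s).
    by rewrite (h_SpSt_sp (c s) (derive1 c s) spA).
  suff mE : - 2^-1 * \tr (th t *m A) = - 2^-1 * \tr (th 0 *m A).
    exact: (mulfI half_neq0 mE).
  apply: (etrans (momE t)); apply: (etrans _ (esym (momE 0))).
  apply: (is_derive_0_cst (F := fun s => h_SpSt (c s) (derive1 c s) (A *m c s)) Ii) => // s Is.
  exact: (derive_killing_momentum LC Io cs cS DC spA Is (D0 s Is)).
apply: (linear_ode Ii I0) => t It; rewrite -/(th 0) -(thE t It).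
rewrite Omega_tilde_id; [exact: smooth_is_derive1|exact: cS|exact: (derive1_tangent Io)].
Qed.

(** exp(tZ) commutes with Z, so c' = exp(tZ) D and equivariance gives
    Omega_tilde(c,c') = exp(tZ) Z exp(-tZ) = Z; the acceleration Z Z c is then
    exactly compensated by the Christoffel term. *)
Lemma expm_geodesic (I : set R) (c : R -> V) U D : open I ->
  SpSt n k U -> tangent_SpSt U D ->
  (forall t, I t -> c t = expm (t *: Omega_tilde U D) *m U) ->
  is_geodesic (SpSt n k) T (@h_SpSt R n k) I c /\
  (forall t, I t -> is_derive t 1 c (Omega_tilde U D *m c t)).
Proof.
move=> Io US UD cE; set th := Omega_tilde U D in cE *.
have gS t : Sp n (expm (t *: th)) by apply: expm_Sp; exact: sp_Omega_tilde.
have cs : smooth_on I c.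
  move=> r; apply: (Cr_ext Io (f := fun t : R => expm (t *: th) *m U)).
    by move=> t It; rewrite cE.
  by apply: (Cr_mulmx Io); [exact: Cr_expm|exact: (Cr_cst Io)].
have cS t : I t -> SpSt n k (c t) by move=> It; rewrite cE //; exact: SpSt_mul.
have near_I (P : R -> Prop) t : (forall s, I s -> P s) -> I t -> \near t, P t.
  by move=> IP It; apply: filterS (open_nbhs_nbhs (conj Io It)).
have cD t : I t -> is_derive t 1 c (th *m c t).
  move=> It; rewrite cE // mulmxA.
  apply: (near_eq_is_derive (f := fun s : R => expm (s *: th) *m U)).
    by apply: near_I => // s Is; rewrite cE.
  exact: (is_derive_mxlin (mulmxr U) (is_derive_expm th t)).
have vE t : I t -> derive1 c t = th *m c t by move=> It; rewrite (is_derive1E (cD t It)).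
split=> //; split=> //; exists SpSt_nabla; first exact: SpSt_levi_civita.
exists (SpSt_cov c); first exact: SpSt_cov_along.
move=> t It; rewrite /SpSt_cov.
have -> : derive1 (derive1 c) t = th *m (th *m c t).
  apply: is_derive1E; apply: (near_eq_is_derive (f := fun s => th *m c s)).
    by apply: near_I => // s Is; rewrite vE.
  exact: (is_derive_mxlin (mulmx th) (cD t It)).
have thE : Omega_tilde (c t) (derive1 c t) = th.
  have -> : derive1 c t = expm (t *: th) *m D.
    by rewrite vE // cE // mulmxA expm_comm -mulmxA Omega_tilde_id.
  rewrite (cE t It) (Omega_tilde_conj _ _ (gS t)) -/th -expm_comm -mulmxA.
  by rewrite (Sp_mulmxV (gS t)) mulmx1.
rewrite /christoffel thE mulmxDl scaleNr scalerDr scale_half2 mulmxA.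
exact: subrr.
Qed.

(** Right multiplication by M^+ = M^-1 identifies the tangent space at M with
    sp(2n), the vertical space with the stabiliser of U = M E, and the metric with
    a multiple of the trace form. *)
Lemma horizontal_liftE M D X : Sp n M ->
  horizontal_lift M D X <->
  [/\ sp (X *m sadj M), (X *m sadj M) *m pi_SpSt k M = D &
    forall W, sp W -> W *m pi_SpSt k M = 0 -> \tr ((X *m sadj M) *m W) = 0].
Proof.
move=> MS; have MV := Sp_mulmxV MS; have VM : sadj M *m M = 1%:M by rewrite -SpE.
have tangE Y : tangent_Sp M Y <-> sp (Y *m sadj M).
  rewrite /tangent_Sp /= sinv_sadj; split=> spY.
    by have := sp_conj M spY; rewrite !mulmxA MV mul1mx.
  by have := sp_conj (sadj M) spY; rewrite sadjK -!mulmxA VM mulmx1.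
have KE Y : Y *m sadj M *m pi_SpSt k M = Y *m E n k.
  by rewrite /pi_SpSt -!mulmxA (mulmxA (sadj M)) VM mul1mx.
have trE Y : sp (X *m sadj M) -> h_Sp X Y = - 2^-1 * \tr (X *m sadj M *m (Y *m sadj M)).
  rewrite spE => spX; rewrite /h_Sp sinv_sadj mulNr -mulrN; congr (_ * _).
  have -> : sadj X = - (sadj M *m X *m sadj M).
    by rewrite -mulmxA -mulmxN -spX sadjM sadjK mulmxA VM mul1mx.
  by rewrite mulNmx linearN /= -!mulmxA mxtrace_mulC -!mulmxA.
have half_neq0 : - 2^-1 != 0 :> R by rewrite oppr_eq0 invr_eq0 pnatr_eq0.
split=> [[/tangE spX orth XE]|[spX XE orth]].
  split=> //; first by rewrite KE.
  move=> W spW WU; apply: (mulfI half_neq0); rewrite mulr0.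
  have -> : W = W *m M *m sadj M by rewrite -mulmxA MV mulmx1.
  rewrite -trE //; apply: orth.
    by apply/tangE; rewrite -mulmxA MV mulmx1.
  by rewrite -mulmxA.
split; [exact/tangE| |by rewrite -KE].
by move=> Y /tangE spY YE; rewrite trE // orth // ?mulr0 // KE.
Qed.

End Geodesics.

Theorem proposition3p7 (R : realType) (n k : nat)
    (k_gt0 : (0 < k)%N) (le_kn : (k <= n)%N)
    (U : 'M[R]_(n + n, k + k)) (U_SpSt : SpSt n k U)
    (M : 'M[R]_(n + n)) (M_Sp : Sp n M) (M_U : pi_SpSt k M = U)
    (Om : 'M[R]_(n + n)) (Om_hor : hor_sp n k Om)
    (Delta : 'M[R]_(n + n, k + k)) (Delta_tan : tangent_SpSt U Delta)
    (Delta_Om : Delta = M *m Om *m E n k) :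
  Omega_tilde U Delta = M *m Om *m sinv M /\
  exists Dhor : 'M[R]_(n + n),
    [/\ forall X, horizontal_lift M Delta X <-> X = Dhor,
        Dhor = Omega_tilde U Delta *m M,
        Dhor = M *m Om,
        forall (I : set R) (gamma : R -> 'M[R]_(n + n, k + k)),
          open I -> is_interval I -> I 0 ->
          [/\ is_geodesic (SpSt n k) (@tangent_SpSt R n k) (@h_SpSt R n k)
                I gamma,
              gamma 0 = U & derive1 gamma 0 = Delta]
          <-> (forall t, I t -> gamma t = pi_SpSt k (Exp_Sp M (t *: Dhor))) &
        forall t : R,
          pi_SpSt k (Exp_Sp M (t *: Dhor)) = M *m expm (t *: Om) *m E n k /\
          M *m expm (t *: Om) *m E n k = expm (t *: Omega_tilde U Delta) *m U].
Proof.
have VM : sadj M *m M = 1%:M by rewrite -SpE.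
have MV := Sp_mulmxV M_Sp.
have lift X : horizontal_lift M Delta X <-> X = Omega_tilde U Delta *m M.
  split=> [/(horizontal_liftE _ _ M_Sp)|->].
    by rewrite M_U => /(Omega_tilde_unique _ U_SpSt Delta_tan) <-; rewrite -mulmxA VM mulmx1.
  apply/(horizontal_liftE _ _ M_Sp); rewrite M_U -mulmxA MV mulmx1.
  exact/(Omega_tilde_unique _ U_SpSt Delta_tan).
have MOm : M *m Om = Omega_tilde U Delta *m M.
  apply/lift; have [spOm Om_orth] := Om_hor; split => //.
    by rewrite /tangent_Sp /= sinv_sadj SpK.
  move=> Y; rewrite /tangent_Sp /= sinv_sadj => spY YE.
  have : h_Sp Om (sadj M *m Y) = 0 by apply: Om_orth => //; rewrite -mulmxA YE mulmx0.
  by rewrite /h_Sp !sinv_sadj sadjM -mulmxA.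
have OmE : Omega_tilde U Delta = M *m Om *m sadj M.
  by rewrite MOm -mulmxA MV mulmx1.
have expE t : pi_SpSt k (Exp_Sp M (t *: (M *m Om))) = M *m expm (t *: Om) *m E n k.
  by rewrite /Exp_Sp sinv_sadj -scalemxAr SpK.
have expE' t : M *m expm (t *: Om) *m E n k = expm (t *: Omega_tilde U Delta) *m U.
  by rewrite -(expm_intertwine _ (esym MOm)) -M_U /pi_SpSt mulmxA.
split; first by rewrite sinv_sadj.
exists (M *m Om); split=> //; first by move=> X; rewrite MOm.
move=> I gamma Io Ii I0; split=> [[geo g0 g'0] t It|gE].
  by rewrite (geodesic_expm Io Ii I0 geo It) g0 g'0 expE expE'.
have gE' t : I t -> gamma t = expm (t *: Omega_tilde U Delta) *m U.
  by move=> It; rewrite gE // expE expE'.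
have [geo gD] := expm_geodesic Io U_SpSt Delta_tan gE'.
have g0 : gamma 0 = U by rewrite gE' // scale0r expm0 mul1mx.
by split=> //; rewrite (is_derive1E (gD 0 I0)) g0 Omega_tilde_id.
Qed.
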